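(* Let $X_n$, $n\in\mathbb{N}$, be a sequence of Polish spaces and let $d_n$ be a Borel pseudo-metric on $X_n$ for each $n$. Denote $E=E((X_n,d_n)_{n\in\mathbb{N}};0)$. Then (i) $\lim_{n\to\infty}\delta(X_n)=0\iff E\le_B\mathbb{R}^{\mathbb{N}}/c_0$; (ii) $(\delta(X_n))_{n\in\mathbb{N}}$ does not converge to $0\iff E_1\le_B E$.
   Context: Polish spaces (separable, completely metrizable spaces) are taken to be nonempty. A Borel pseudo-metric on $X_n$ is a pseudo-metric $d_n:X_n\times X_n\to[0,\infty)$ that is a Borel function; it need not be related to the topology of $X_n$. For pseudo-metric spaces $(X_n,d_n)$, $E((X_n,d_n)_{n\in\mathbb{N}};0)$ is the equivalence relation on $\prod_{n\in\mathbb{N}}X_n$ (with the product Polish topology) given by: $(x,y)\in E((X_n,d_n)_{n\in\mathbb{N}};0)$ iff $\lim_{n\to\infty}d_n(x(n),y(n))=0$. For $\delta>0$, $(X,d)$ is $\delta$-separable if there is a countable $S\subseteq X$ such that for every $u\in X$ there is $s\in S$ with $d(u,s)<\delta$. For a pseudo-metric space $(X,d)$, $\delta(X)=\inf\{\delta>0: X\text{ is }\delta\text{-separable}\}$ (with $\inf\emptyset=+\infty$). $\mathbb{R}^{\mathbb{N}}/c_0$ is the equivalence relation on $\mathbb{R}^{\mathbb{N}}$ given by $x\sim y$ iff $x-y\in c_0$, i.e. $\lim_n (x(n)-y(n))=0$. $E_1$ is the equivalence relation on $2^{\mathbb{N}\times\mathbb{N}}$: $(x,y)\in E_1\iff\exists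 m\,\forall n\ge m\,\forall k\,(x(n,k)=y(n,k))$. For equivalence relations $E,F$ on Polish spaces $X,Y$, $E\le_B F$ ($E$ is Borel reducible to $F$) means there is a Borel function $\theta:X\to Y$ such that $(x,y)\in E\iff(\theta(x),\theta(y))\in F$ for all $x,y\in X$. *)

(* Defs.v *)
From HB Require Import structures.
From mathcomp Require Import all_boot all_order all_algebra.
From mathcomp Require Import all_classical all_reals all_analysis.
Set Implicit Arguments.
Unset Strict Implicit.
Unset Printing Implicit Defensive.
Import Order.TTheory GRing.Theory Num.Theory.
Import numFieldNormedType.Exports.
Local Open Scope classical_set_scope.
Local Open Scope ring_scope.

(* Not tied to any topology on X, unlike the library's pseudoMetricType. *)
Definition pseudo_metric (R : realType) (X : Type) (d : X -> X -> R) : Prop :=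
  [/\ forall x y, 0 <= d x y,
      forall x, d x x = 0,
      forall x y, d x y = d y x &
      forall x y z, d x z <= d x y + d y z].

Definition metric (R : realType) (X : Type) (d : X -> X -> R) : Prop :=
  pseudo_metric d /\ forall x y, d x y = 0 -> x = y.

Definition metrizes (R : realType) (X : topologicalType) (d : X -> X -> R) :
    Prop :=
  forall (x : X) (U : set X),
    nbhs x U <-> exists2 e : R, 0 < e & [set y | d x y < e] `<=` U.

Definition cauchy_for (R : realType) (X : Type) (d : X -> X -> R)
    (u : nat -> X) : Prop :=
  forall e : R, 0 < e -> exists N : nat,
    forall m n : nat, (N <= m)%N -> (N <= n)%N -> d (u m) (u n) < e.

Definition separable_space (X : topologicalType) : Prop :=
  exists2 S : set X, countable S & dense S.

Definition completely_metrizable (R : realType) (X : topologicalType) : Prop :=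
  exists d : X -> X -> R,
    [/\ metric d, metrizes d &
        forall u : nat -> X, cauchy_for d u -> exists l : X, u @ \oo --> l].

Definition polish (R : realType) (X : topologicalType) : Prop :=
  [/\ [set: X] !=set0, separable_space X & completely_metrizable R X].

(* Written out rather than as measurable_fun: the library puts a sigma-algebra
   structure on g_sigma_algebraType only over pointed types. *)
Definition borel_fun (X Y : topologicalType) (f : X -> Y) : Prop :=
  forall B : set Y, <<s @open Y >> B -> <<s @open X >> (f @^-1` B).

Definition borel_pseudo_metric (R : realType) (X : topologicalType)
    (d : X -> X -> R) : Prop :=
  pseudo_metric d /\ borel_fun (fun p : X * X => d p.1 p.2).

Definition delta_separable (R : realType) (X : Type) (d : X -> X -> R)
    (delta : R) : Prop :=
  exists2 S : set X, countable S &
    forall u : X, exists2 s : X, S s & d u s < delta.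

Definition delta_of (R : realType) (X : Type) (d : X -> X -> R) : \bar R :=
  ereal_inf [set e%:E | e in [set e : R | 0 < e /\ delta_separable d e]].

(* E((X_n, d_n)_n; 0); prod_topology carries the topology of pointwise
   convergence, which is where borel_reducible reads the Borel sets from. *)
Definition E_zero (R : realType) (X : nat -> topologicalType)
    (d : forall n, X n -> X n -> R) (x y : prod_topology X) : Prop :=
  (fun n => d n (x n) (y n)) @ \oo --> (0 : R).

Definition RN_mod_c0 (R : realType) (x y : {ptws nat -> R}) : Prop :=
  (fun n => x n - y n) @ \oo --> (0 : R).

Definition E_one (x y : {ptws (nat * nat)%type -> bool}) : Prop :=
  exists m : nat, forall n : nat, (m <= n)%N ->
    forall k : nat, x (n, k) = y (n, k).

Definition borel_reducible (X Y : topologicalType)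
    (E : X -> X -> Prop) (F : Y -> Y -> Prop) : Prop :=
  exists2 theta : X -> Y, borel_fun theta &
    forall x y : X, E x y <-> F (theta x) (theta y).

(* Main.v *)
(** The two reducibilities exclude each other because [E_one] does not reduce to
    [RN_mod_c0], so it suffices to produce a reduction on each side.

    If [delta(X_n)] tends to 0, truncated distances to the points of a countable net
    give, at each scale [r] for which [X_n] is [r]-separable, 1-Lipschitz maps into
    finitely supported sequences that separate points at distance [5 r]; their
    coordinates over all [n] and all scales [2^-j] with [j <= n] form the reduction.

    If [delta(X_n)] does not tend to 0, infinitely many [X_n] fail to be
    [eps]-separable.  The sets covered by countably many [eps]-balls then form a proper
    sigma-ideal, and a fusion argument along a closed representation of the
    analytic set [d >= eps] yields a continuous map of the Cantor space into [X_n]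
    which is [eps]-separated on distinct points with the same tail.  Hence the set of
    pairs at distance [< eps / 2] is meagre, and Mycielski's construction gives a Cantor
    set which is [eps / 2]-separated.

    If [theta] reduced [E_one] to [RN_mod_c0], it would be continuous off a meagre set.
    By Baire category, on small boxes some flip of one bit in a given column moves
    [theta] by at most a prescribed amount in the sup norm.  Flipping one bit in each
    column with summable displacements gives two points that are not [E_one]-related
    but whose images differ by a null sequence. *)

Require Import Defs.
From mathcomp Require Import all_boot all_order all_algebra.
From mathcomp Require Import all_classical all_reals all_analysis.
From mathcomp Require Import lra.
Import Order.TTheory GRing.Theory Num.Theory.
Import numFieldNormedType.Exports.
Local Open Scope classical_set_scope.
Local Open Scope ring_scope.

(** The fusion arguments below are instances: [Q] is the invariant at stage [n], [P] relates
    consecutive stages. *)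
Lemma dependent_choice_nat {T : Type} (Q : nat -> set T) (P : nat -> T -> T -> Prop)
    (t0 : T) :
  Q 0%N t0 ->
  (forall n t, Q n t -> exists2 t', Q n.+1 t' & P n t t') ->
  exists f : nat -> T, [/\ f 0%N = t0, forall n, Q n (f n) &
    forall n, P n (f n) (f n.+1)].
Proof.
move=> Q0 step.
have /choice[h hP] (p : nat * T) : exists t, Q p.1 p.2 ->
    Q p.1.+1 t /\ P p.1 p.2 t.
  case: p => n t; have [Qt|nQt] := pselect (Q n t).
    by have [t' ? ?] := step n t Qt; exists t'.
  by exists t.
pose f := fix f n := if n is m.+1 then h (m, f m) else t0.
have Qf n : Q n (f n) by elim: n => //= n IH; have [] := hP (n, f n) IH.
by exists f; split=> // n; have [] := hP (n, f n) (Qf n).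
Qed.

(** * Baire category in a power of a discrete space *)

Section Category.
Context {I : eqType} {A : Type}.
Implicit Types (x y z : I -> A) (D : seq I) (N M S : set (I -> A)).

(* The basic open neighbourhoods of [x] are the boxes [[set y | agree D x y]]. *)
Definition agree D x y := forall i, i \in D -> x i = y i.

Lemma agree_trans D x y z : agree D x y -> agree D y z -> agree D x z.
Proof. by move=> xy yz i iD; rewrite xy// yz. Qed.

Lemma agreeS D D' x y : {subset D <= D'} -> agree D' x y -> agree D x y.
Proof. by move=> DD' xy i iD; apply/xy/DD'. Qed.

Definition box_nowhere_dense N := forall z D, exists z' D',
  [/\ {subset D <= D'}, agree D z z' & forall y, agree D' z' y -> ~ N y].

Definition box_meagre M :=
  exists2 N : nat -> set (I -> A), forall k, box_nowhere_dense (N k) &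
    forall x, M x -> exists k, N k x.

Lemma box_nowhere_dense0 : box_nowhere_dense set0.
Proof. by move=> z D; exists z, D; split=> [i iD|i iD|y _ []]. Qed.

Lemma box_nowhere_dense_meagre N : box_nowhere_dense N -> box_meagre N.
Proof. by move=> nN; exists (fun=> N) => // x Nx; exists 0%N. Qed.

Lemma box_meagreS M M' : M `<=` M' -> box_meagre M' -> box_meagre M.
Proof. by move=> MM' [N nN MN]; exists N => // x /MM' /MN. Qed.

Lemma box_meagre_countable (J : countType) (M : J -> set (I -> A)) :
  (forall j, box_meagre (M j)) -> box_meagre [set x | exists j, M j x].
Proof.
move=> mM.
have /choice[N nN] j : exists N : nat -> set (I -> A),
    (forall k, box_nowhere_dense (N k)) /\ forall x, M j x -> exists k, N k x.
  by have [N ? ?] := mM j; exists N.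
exists (fun n => if @unpickle (J * nat)%type n is Some (j, k) then N j k else set0).
  move=> n; case: unpickle => [[j k]|]; last exact: box_nowhere_dense0.
  by have [] := nN j.
move=> x [j Mx]; have [_ /(_ x Mx) [k Nx]] := nN j.
by exists (pickle (j, k)); rewrite pickleK.
Qed.

Lemma box_meagreU M M' : box_meagre M -> box_meagre M' -> box_meagre (M `|` M').
Proof.
move=> mM mM'; apply: (@box_meagreS _
    [set x | exists b : bool, (if b then M else M') x]).
  by move=> x [?|?]; [exists true|exists false].
by apply: box_meagre_countable => -[].
Qed.

(** Once [i] enters some [D n] its value is frozen; coordinates that never enter receive the default
    [a]. *)
Lemma box_limit (a : A) (z : nat -> I -> A) (D : nat -> seq I) :
  (forall n, {subset D n <= D n.+1}) ->
  (forall n, agree (D n) (z n) (z n.+1)) ->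
  exists x, forall n, agree (D n) (z n) x.
Proof.
move=> DS zS.
have D_le m n : (m <= n)%N -> {subset D m <= D n}.
  by move=> /subnK <-; elim: (n - m)%N => // k IH i /IH; rewrite addSn; apply: DS.
have z_le m n : (m <= n)%N -> agree (D m) (z m) (z n).
  move=> /subnK <-; elim: (n - m)%N => // k IH; rewrite addSn.
  by apply: agree_trans IH _ => i /(D_le _ _ (leq_addl k m)); apply: zS.
have /choice[x xP] i : exists a, forall n, i \in D n -> z n i = a.
  have [[n iD]|niD] := pselect (exists n, i \in D n); last first.
    by exists a => n iD; case: niD; exists n.
  exists (z n i) => m iDm; have [mn|/ltnW nm] := leqP m n.
    exact: z_le mn _ iDm.
  by rewrite (z_le _ _ nm).
by exists x => n i; apply: xP.
Qed.

Lemma baire M z D : box_meagre M -> exists2 x, agree D z x & ~ M x.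
Proof.
(* With no index at all there is a single point, lying in every box, so no nowhere dense set
   contains it. Otherwise [z i0] is the default value for [box_limit]. *)
move=> [N nN MN]; have [i0|noI] := pselect (inhabited I); last first.
  exists z => // /MN[k Nz]; have [z' [D' [_ _ /(_ z)]]] := nN k z [::].
  by apply=> // i; case: noI.
case: i0 => i0.
have [||f [f0 _ fS]] := @dependent_choice_nat ((I -> A) * seq I)%type (fun=> setT)
    (fun k s t => [/\ {subset s.2 <= t.2}, agree s.2 s.1 t.1 &
     forall y, agree t.2 t.1 y -> ~ N k y]) (z, D) => //.
  by move=> k [x E] _; have [z' [D' ?]] := nN k x E; exists (z', D').
have [||x xP] := @box_limit (z i0) (fst \o f) (snd \o f).
- by move=> n; have [] := fS n.
- by move=> n; have [] := fS n.
exists x; first by have := xP 0%N; rewrite /= f0.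
by move=> /MN[k]; have [_ _] := fS k; apply; apply: xP.
Qed.

(* Equivalent to the usual Baire property: off a meagre set, [S] is clopen. *)
Definition baire_property S := exists2 M, box_meagre M &
  forall x, ~ M x -> exists D, forall y, agree D x y -> ~ M y -> (S x <-> S y).

Definition box_open S := forall x, S x -> exists D, forall y, agree D x y -> S y.

(** A box that meets [S] shrinks into [S] by openness; a box that misses [S] contains no point of
    its closure. *)
Lemma box_boundary_nowhere_dense S : box_open S ->
  box_nowhere_dense [set x | ~ S x /\ forall D, exists2 y, agree D x y & S y].
Proof.
move=> oS z D; have [[y zy /oS[D' yD']]|noS] := pselect (exists2 y, agree D z y & S y).
  exists y, (D ++ D'); split=> //; first by move=> i iD; rewrite mem_cat iD.
  by move=> x yx [+ _]; apply; apply: yD' => i iD'; rewrite yx// mem_cat iD' orbT.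
exists z, D; split=> // x zx [_ /(_ D) [y xy Sy]]; apply: noS.
by exists y => //; apply: agree_trans xy.
Qed.

Lemma box_open_baire_property S : box_open S -> baire_property S.
Proof.
move=> oS; exists [set x | ~ S x /\ forall D, exists2 y, agree D x y & S y].
  exact/box_nowhere_dense_meagre/box_boundary_nowhere_dense.
move=> x; have [/[dup] Sx /oS[D xD] _|nSx /not_andP[//|/existsNP[D xD]]] := pselect (S x).
  by exists D => y /xD.
by exists D => y xy _; split=> // Sy; exfalso; apply: xD; exists y.
Qed.

(** For a countable union, [U] collects the points with a box on which the union is everything off
    [M0], and its boundary [B] is nowhere dense. A point off [M0] and [B] is either in [U] or has a
    box disjoint from [U]; such a box contains no point of the union off [M0], since that point
    would lie in [U]. *)
Lemma baire_property_sigma_algebra : sigma_algebra setT baire_property.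
Proof.
split.
- exists set0; last by move=> x _; exists [::].
  exact/box_nowhere_dense_meagre/box_nowhere_dense0.
- move=> S [M mM SM]; exists M => // x /SM[D xD]; exists D => y xy My.
  by have [? ?] := xD y xy My; split=> -[_ nS]; split=> // ?; apply: nS; tauto.
move=> S bS.
have /choice[M MP] n : exists M, box_meagre M /\ forall x, ~ M x ->
    exists D, forall y, agree D x y -> ~ M y -> (S n x <-> S n y).
  by have [M ? ?] := bS n; exists M.
pose M0 := [set x | exists n, M n x].
pose U := [set x | exists D, forall y, agree D x y -> ~ M0 y ->
  (\bigcup_n S n) y].
pose B := [set x | ~ U x /\ forall D, exists2 y, agree D x y & U y].
have nB : box_nowhere_dense B.
  apply: box_boundary_nowhere_dense => x [D xD]; exists D => y xy; exists D => w yw.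
  by apply: xD; apply: agree_trans xy yw.
exists (M0 `|` B).
  apply: box_meagreU; last exact: box_nowhere_dense_meagre.
  by apply: box_meagre_countable => n; have [] := MP n.
move=> x /not_orP[M0x Bx]; have [Ux|nUx] := pselect (U x).
  have [D xD] := Ux; exists D => y xy /not_orP[M0y _]; split=> _.
    exact: xD.
  exact: xD.
have [D xD] : exists D, ~ exists2 y, agree D x y & U y.
  by apply: contrapT => nD; apply: Bx; split=> // D; apply: contrapT => ?; apply: nD; exists D.
have notS y : agree D x y -> ~ M0 y -> ~ (\bigcup_n S n) y.
  move=> xy M0y [n _ Sy]; apply: xD; exists y => //.
  have [_ /(_ y) []] := MP n; first by move=> My; apply: M0y; exists n.
  move=> D' yD'; exists D' => w yw M0w; exists n => //.
  by apply/(yD' w yw) => // Mw; apply: M0w; exists n.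
exists D => y xy /not_orP[M0y _]; split=> [Sx|Sy]; exfalso.
  exact: notS Sx.
exact: notS Sy.
Qed.

End Category.

Lemma box_meagre_preimage {I : eqType} {A A' : Type} (c : I -> A' -> A) (M : set (I -> A)) :
  (forall i a, exists a', c i a' = a) -> box_meagre M ->
  box_meagre [set z : I -> A' | M (fun i => c i (z i))].
Proof.
move=> csurj [N nN MN].
exists (fun k => [set z | N k (fun i => c i (z i))]); last by move=> z /MN.
move=> k z D; have [x [D' [DD' zx xN]]] := nN k (fun i => c i (z i)) D.
have [s sP] := choice (fun p : I * A => csurj p.1 p.2).
(* The box found downstairs is lifted by keeping [z] on [D], where it already maps correctly, and
   choosing preimages elsewhere. *)
exists (fun i => if i \in D then z i else s (i, x i)), D'; split=> //.
  by move=> i iD; rewrite iD.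
move=> y zy; apply: xN => i iD'; rewrite -zy//; case: ifPn => [/zx//|_].
by rewrite (sP (i, x i)).
Qed.


(** * [E_one] is not reducible to [RN_mod_c0] *)

Section Flips.
Context {I : eqType}.
Implicit Types (x y : I -> bool) (s : seq I) (D : seq I).

Definition flips s x : I -> bool := fun i => x i (+) odd (count_mem i s).

Lemma flips_cat s s' x : flips s (flips s' x) = flips (s ++ s') x.
Proof.
by apply/funext => i; rewrite /flips count_cat oddD -addbA [X in x i (+) X]addbC.
Qed.

Lemma flipsK s : involutive (flips s).
Proof.
by move=> x; apply/funext => i; rewrite flips_cat /flips count_cat oddD addbb addbF.
Qed.

Lemma agree_flip p D x : p \notin D -> agree D x (flips [:: p] x).
Proof.
move=> pD i iD; rewrite /flips /= addn0; case: eqP => [pi|_]; last by rewrite addbF.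
by rewrite pi iD in pD.
Qed.

Lemma box_meagre_flips s (M : set (I -> bool)) :
  box_meagre M -> box_meagre [set x | M (flips s x)].
Proof.
apply: (@box_meagre_preimage I bool bool (fun i b => b (+) odd (count_mem i s))).
by move=> i b; exists (b (+) odd (count_mem i s)); rewrite -addbA addbb addbF.
Qed.

End Flips.

(** Finite flips are countably many homeomorphisms, so the saturation of [M] is still meagre.
    Removing it leaves good points that stay good under flips. *)
Lemma flip_invariant_hull {I : countType} (M : set (I -> bool)) : box_meagre M ->
  exists M', [/\ box_meagre M', M `<=` M' & forall s x, M' (flips s x) -> M' x].
Proof.
move=> mM; exists [set x | exists s, M (flips s x)]; split.
- by apply: box_meagre_countable => s; apply: box_meagre_flips.
- by move=> x Mx; exists [::]; suff -> : flips [::] x = x by []; apply/funext => i;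
    rewrite /flips addbF.
- by move=> s x [s' Mx]; exists (s' ++ s); rewrite -flips_cat.
Qed.

Lemma near0P (R : realType) (u : nat -> R) :
  (u @ \oo --> (0 : R)) <->
  (forall e, 0 < e -> exists N, forall n, (N <= n)%N -> `|u n| < e).
Proof.
split=> [/cvgr0Pnorm_lt u0 e e0|u0].
  by have [N _ uN] := u0 e e0; exists N => n Nn; apply: uN.
by apply/cvgr0Pnorm_lt => e /u0[N uN]; exists N => // n /= /uN.
Qed.

Lemma two_over_expn_small {R : realType} (e : R) : 0 < e -> exists n, 2 / 2 ^+ n < e.
Proof.
move=> e0; have /near0P/(_ e e0)[n /(_ n (leqnn n)) h] :
    (fun n => 2 * 2^-1 ^+ n : R) @ \oo --> (0 : R).
  rewrite -[X in _ --> X](mulr0 2); apply: cvgMr; apply: cvg_expr.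
  by rewrite ger0_norm; lra.
by exists n; move: h; rewrite exprVn ger0_norm// ltW// divr_gt0// exprn_gt0.
Qed.

Definition continuous_off {I : eqType} {A : Type} {R : realType} (M : set (I -> A))
    (f : (I -> A) -> R) :=
  forall x, ~ M x -> forall e, 0 < e ->
    exists D, forall y, agree D x y -> ~ M y -> `|f x - f y| < e.

(** One exceptional set serves all rational half-lines; rationals within [e] on either side of
    [f j x] then trap the nearby values. *)
Lemma continuous_off_meagre {I : eqType} {A : Type} {R : realType} {J : countType}
    (f : J -> (I -> A) -> R) :
  (forall j (q : rat), baire_property [set x | f j x < ratr q]) ->
  exists2 M, box_meagre M & forall j, continuous_off M (f j).
Proof.
move=> bf.
have /choice[M MP] (p : J * rat) : exists M, box_meagre M /\ forall x, ~ M x ->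
    exists D, forall y, agree D x y -> ~ M y ->
      (f p.1 x < ratr p.2 <-> f p.1 y < ratr p.2).
  by have [M ? ?] := bf p.1 p.2; exists M.
exists [set x | exists p, M p x].
  by apply: box_meagre_countable => p; have [] := MP p.
move=> j x nMx e e0.
have [|q1] := @rat_in_itvoo _ (f j x - e) (f j x); first by lra.
have [|q2] := @rat_in_itvoo _ (f j x) (f j x + e); first by lra.
rewrite !in_itv /= => /andP[q2x q2e] /andP[q1e q1x].
have [_ /(_ x) [|D1 D1P]] := MP (j, q1); first by move=> Mx; apply: nMx; exists (j, q1).
have [_ /(_ x) [|D2 D2P]] := MP (j, q2); first by move=> Mx; apply: nMx; exists (j, q2).
exists (D1 ++ D2) => y xy nMy.
have y1 : ~ f j y < ratr q1.
  move=> yq; suff : f j x < ratr q1 by lra.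
  apply/(D1P y) => //; first by apply: agreeS xy => i iD; rewrite mem_cat iD.
  by move=> My; apply: nMy; exists (j, q1).
have y2 : f j y < ratr q2.
  apply/(D2P y) => //; first by apply: agreeS xy => i iD; rewrite mem_cat iD orbT.
  by move=> My; apply: nMy; exists (j, q2).
by rewrite ltr_norml; apply/andP; split; move/negP: y1; rewrite -leNgt; lra.
Qed.

Lemma continuous_off_finite {I : eqType} {A : Type} {R : realType} (M : set (I -> A))
    (f : nat -> (I -> A) -> R) (N : nat) :
  (forall k, continuous_off M (f k)) ->
  forall x, ~ M x -> forall e, 0 < e ->
    exists D, forall y, agree D x y -> ~ M y ->
      forall k, (k < N)%N -> `|f k x - f k y| < e.
Proof.
move=> cf x Mx e e0; elim: N => [|N [D DP]]; first by exists [::].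
have [D' D'P] := cf N x Mx e e0; exists (D ++ D') => y xy My k.
rewrite ltnS leq_eqVlt => /predU1P[->|kN].
  by apply: D'P => //; apply: agreeS xy => i iD; rewrite mem_cat iD orbT.
by apply: DP => //; apply: agreeS xy => i iD; rewrite mem_cat iD.
Qed.

Section NoReduction.
Context {R : realType}.
Variables (theta : (nat * nat -> bool) -> nat -> R).
Hypothesis theta_red : forall x y, E_one x y <->
  forall e : R, 0 < e -> exists N, forall k, (N <= k)%N -> `|theta x k - theta y k| < e.
Variable M : set (nat * nat -> bool).
Hypothesis meagreM : box_meagre M.
Hypothesis flipM : forall s x, M (flips s x) -> M x.
Hypothesis contM : forall k, continuous_off M (theta^~ k).

Let fstP (w : nat * nat -> bool * bool) i := (w i).1.
Let mixP (m : nat) (w : nat * nat -> bool * bool) i :=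
  if i.1 == m then (w i).2 else (w i).1.
Let Mpair m := [set w | M (fstP w)] `|` [set w | M (mixP m w)].

Let meagre_Mpair m : box_meagre (Mpair m).
Proof.
apply: box_meagreU.
  apply: (@box_meagre_preimage _ bool (bool * bool) (fun=> fst)) => // i b.
  by exists (b, b).
apply: (@box_meagre_preimage _ bool (bool * bool)
  (fun i b => if i.1 == m then b.2 else b.1)) => // i b.
by exists (b, b); case: ifP.
Qed.

(* The pair [w] encodes two points which differ in column [m] only, hence are
   [E_one]-equivalent: the Baire category theorem makes the rate of convergence
   uniform on a box. *)
Let uniform_tail (z : nat * nat -> bool) (D : seq (nat * nat)) m (e : R) :
  0 < e -> exists N w0 D0, [/\ {subset D <= D0},
  agree D z (fstP w0) & forall w, agree D0 w0 w -> ~ Mpair m w ->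
    forall k, (N <= k)%N -> `|theta (fstP w) k - theta (mixP m w) k| <= e].
Proof.
move=> e0; apply: contrapT => nex.
pose zz i := (z i, z i).
pose S N := [set w | [/\ agree D zz w, ~ Mpair m w & forall k, (N <= k)%N ->
   `|theta (fstP w) k - theta (mixP m w) k| <= e]].
(* By [nex], every box compatible with [D] contains a pair off [Mpair m] violating the bound at some
   [k >= N]. The excess [a - e], split between the two points, makes the violation persist on a
   smaller box. *)
have nS N : box_nowhere_dense (S N).
  move=> w D'.
  have [[w1 ww1 zw1]|no] := pselect (exists2 w1, agree D' w w1 & agree D zz w1); last first.
    exists w, D'; split=> // y wy [zy _ _]; apply: no; by exists y.
  have [w2 [w12 Mw2 [k Nk kw2]]] : exists w2, [/\ agree (D' ++ D) w1 w2, ~ Mpair m w2 &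
     exists2 k, (N <= k)%N & e < `|theta (fstP w2) k - theta (mixP m w2) k|].
    apply: contrapT => no; apply: nex; exists N, w1, (D' ++ D); split.
    - by move=> i iD; rewrite mem_cat iD orbT.
    - by move=> i iD; rewrite /fstP -zw1.
    move=> w2 w12 Mw2 k Nk; rewrite leNgt; apply/negP => ek; apply: no.
    by exists w2; split=> //; exists k.
  have /not_orP[Mf Mm] := Mw2.
  set a := `|_| in kw2.
  have [|D1 D1P] := contM k _ Mf ((a - e) / 2); first by lra.
  have [|D2 D2P] := contM k _ Mm ((a - e) / 2); first by lra.
  exists w2, (D' ++ D ++ D1 ++ D2); split.
  - by move=> i iD; rewrite mem_cat iD.
  - by move=> i iD; rewrite ww1// w12// mem_cat iD.
  move=> y w2y [_ /not_orP[My1 My2] /(_ k Nk)].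
  have /D2P/(_ My2) h2 : agree D2 (mixP m w2) (mixP m y).
    by move=> i iD; rewrite /mixP w2y// !mem_cat iD !orbT.
  have /D1P/(_ My1) h1 : agree D1 (fstP w2) (fstP y).
    by move=> i iD; rewrite /fstP w2y// !mem_cat iD !orbT.
  rewrite leNgt => /negP; apply; move: h1 h2; rewrite /a.
  set t1 := theta _ _; set t2 := theta _ _; set t3 := theta _ _; set t4 := theta _ _.
  have := ler_distD t2 t1 t3; have := ler_distD t4 t2 t3; rewrite [`|t4 - t3|]distrC.
  by lra.
have [w zw] : exists2 w, agree D zz w & ~ (Mpair m `|` [set w | exists N, S N w]) w.
  apply: baire; apply: box_meagreU => //; apply: box_meagre_countable => N.
  exact: box_nowhere_dense_meagre.
move=> /not_orP[Mw]; apply.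
have /theta_red/(_ e e0)[N NP] : E_one (fstP w) (mixP m w).
  by exists m.+1 => n mn k; rewrite /mixP /= gtn_eqF.
by exists N; split=> // k /NP/ltW.
Qed.

(** For [k < N], continuity at [x1] controls both [x] and its flip. For [k >= N], both are compared
    with a common point that differs from them in column [m] only: each comparison costs [e / 3] by
    [uniform_tail], and the rest is approximation error. *)
Let small_flip (z : nat * nat -> bool) (D : seq (nat * nat)) m (e : R) :
  0 < e -> exists z' D' j, [/\ {subset D <= D'},
  agree D z z', (m, j) \notin D' & forall x, agree D' z' x -> ~ M x ->
    forall k, `|theta (flips [:: (m, j)] x) k - theta x k| <= e].
Proof.
move=> e0; have [|N [w0 [D0 [DD0 zw0 w0P]]]] := @uniform_tail z D m (e / 3); first by lra.
have [x1 wx1 Mx1] := baire _ (fstP w0) D0 meagreM.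
have [|D1 D1P] := continuous_off_finite _ _ N contM _ Mx1 (e / 2); first by lra.
pose D' := D0 ++ D1.
(* A second coordinate above all those in [D'] makes the flip invisible to the box. *)
have [j jD'] : exists j, (m, j) \notin D'.
  exists (\max_(p <- D') p.2).+1; apply/negP => /(@leq_bigmax_seq _ _ predT snd).
  by rewrite /= ltnn => /(_ isT).
exists x1, D', j; split=> //.
- by move=> i /DD0 iD0; rewrite mem_cat iD0.
- by move=> i iD; rewrite zw0// wx1// DD0.
set p := (m, j) in jD' *.
move=> x x1x Mx k; pose x' := flips [:: p] x.
have Mx' : ~ M x' by move/flipM.
have xx' : agree D' x x' by apply: agree_flip.
have [kN|Nk] := ltnP k N.
  have /D1P/(_ Mx k kN) h1 : agree D1 x1 x.
    by move=> i iD; apply: x1x; rewrite mem_cat iD orbT.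
  have /D1P/(_ Mx' k kN) h2 : agree D1 x1 x'.
    by move=> i iD; rewrite -xx'; [apply: x1x|]; rewrite mem_cat iD orbT.
  have := ler_distD (theta x1 k) (theta x' k) (theta x k).
  rewrite [`|theta x' k - theta x1 k|]distrC.
  by rewrite -/x'; lra.
rewrite leNgt; apply/negP; rewrite -/x'; set a := `|_| => ea.
have [|D2 D2P] := contM k _ Mx ((a - e * 2 / 3) / 2); first by lra.
have [|D3 D3P] := contM k _ Mx' ((a - e * 2 / 3) / 2); first by lra.
(* The pair is moved off [Mpair m] by Baire category. Flipping [p] in its first component leaves
   [mixP m] unchanged, because [p] lies in column [m]. *)
pose w1 i := (x i, (w0 i).2).
have [w w1w] : exists2 w, agree (D0 ++ D2 ++ D3 ++ [:: p]) w1 w &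
    ~ Mpair m w by apply: baire.
move=> /not_orP[Mw Mmw].
pose w' i := (flips [:: p] (fstP w) i, (w i).2).
have mixw' : mixP m w' = mixP m w.
  apply/funext => i; rewrite /mixP /w' /=; case: eqP => // im.
  rewrite /flips /= addn0 /fstP; case: eqP => [pi|]; last by rewrite addbF.
  by case: im; rewrite -pi.
have w0w : agree D0 w0 w.
  move=> i iD; rewrite -w1w ?mem_cat ?iD// /w1 -x1x ?mem_cat ?iD// -wx1//.
  by rewrite /fstP; case: (w0 i).
have w0w' : agree D0 w0 w'.
  have pD0 : p \notin D0 by apply: contra jD' => pD; rewrite mem_cat pD.
  by move=> i iD; rewrite /w' -(agree_flip _ _ (fstP w) pD0)// w0w// /fstP; case: (w i).
have h1 := w0P w w0w (proj2 (not_orP _ _) (conj Mw Mmw)) k Nk.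
have Mw' : ~ M (fstP w') by move/(@flipM [:: p] (fstP w)).
have := w0P w' w0w'; rewrite /Mpair /= mixw' => /(_ (proj2 (not_orP _ _) (conj Mw' Mmw)) k Nk) h2.
have /D2P/(_ Mw) h3 : agree D2 x (fstP w).
  by move=> i iD; rewrite /fstP -w1w// !mem_cat iD !orbT.
have /D3P/(_ Mw') h4 : agree D3 x' (fstP w').
  by move=> i iD; rewrite /x' /fstP /w' /flips /fstP /= -w1w// !mem_cat iD !orbT.
move: h1 h2 h3 h4 ea; rewrite /a.
set t1 := theta x k; set t2 := theta x' k; set t3 := theta _ _; set t4 := theta _ _;
  set t5 := theta _ _.
rewrite !ltr_norml !ler_norml; case: (lerP 0 (t2 - t1)) => [/ger0_norm|/ltr0_norm] ->;
  move=> /andP[? ?] /andP[? ?] /andP[? ?] /andP[? ?]; lra.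
Qed.

Lemma no_continuous_off_reduction : False.
Proof.
have [N nN MN] := meagreM.
(* A stage is a point, a finite domain and the list of flips chosen so far. Stage [n] avoids [N n]
   twice: on the box itself and after undoing the earlier flips. *)
pose P n (s t : (nat * nat -> bool) * seq (nat * nat) * seq (nat * nat)) :=
  [/\ {subset s.1.2 <= t.1.2}, agree s.1.2 s.1.1 t.1.1,
    exists j, [/\ t.2 = (n, j) :: s.2, (n, j) \notin t.1.2 &
      forall x, agree t.1.2 t.1.1 x -> ~ M x -> forall k,
        `|theta (flips [:: (n, j)] x) k - theta x k| <= 1 / 2 ^+ n] &
    forall y, agree t.1.2 t.1.1 y -> ~ N n y /\ ~ N n (flips s.2 y)].
have [||f [f0 _ fS]] := @dependent_choice_nat _ (fun=> setT) P (fun=> true, [::], [::]) => //.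
  move=> n [[z D] s] _.
  have [z1 [D1 [DD1 zz1 z1N]]] := nN n z D.
  have [y1 z1y1 [D2 /= ]] : exists2 y1, agree D1 z1 y1 & exists D2, {subset D1 <= D2} /\
      forall y, agree D2 y1 y -> ~ N n (flips s y).
    have [z2 [D2 [DD2 zz2 z2N]]] := nN n (flips s z1) D1.
    exists (flips s z2); first by move=> i /zz2; rewrite /flips => <-; rewrite -addbA addbb addbF.
    exists D2; split=> // y z2y; apply: z2N => i iD.
    by rewrite /flips -z2y// /flips -addbA addbb addbF.
  move=> [D12 y1N].
  have [|z3 [D3 [j [D23 y1z3 jD3 z3P]]]] := @small_flip y1 D2 n (1 / 2 ^+ n).
    by rewrite divr_gt0// exprn_gt0.
  exists (z3, D3, (n, j) :: s) => //; split=> /=.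
  - by move=> i /DD1/D12/D23.
  - by move=> i iD; rewrite zz1// z1y1 ?DD1// y1z3// D12// DD1.
  - by exists j.
  move=> y z3y; split.
    by apply: z1N => i iD; rewrite z1y1// y1z3 ?D12// z3y// D23// D12.
  by apply: y1N => i iD; rewrite y1z3// z3y// D23.
pose z n := (f n).1.1; pose D n := (f n).1.2; pose s n := (f n).2.
have DS n : {subset D n <= D n.+1} by have [] := fS n.
have D_le m n : (m <= n)%N -> {subset D m <= D n}.
  by move=> /subnK <-; elim: (n - m)%N => // k IH i /IH; rewrite addSn; apply: DS.
have [|y yP] := box_limit true z D DS; first by move=> n; have [] := fS n.
have /choice[j jP] n : exists j, [/\ s n.+1 = (n, j) :: s n, (n, j) \notin D n.+1 &
    forall x, agree (D n.+1) (z n.+1) x -> ~ M x -> forall k,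
    `|theta (flips [:: (n, j)] x) k - theta x k| <= 1 / 2 ^+ n] by have [] := fS n.
(* [Y n] is the limit [y] flipped at the chosen bit of every column from [n] on: [Y 0] differs from
   [y] in every column, but from [Y n] in finitely many bits only. *)
pose Y n (p : nat * nat) := y p (+) ((n <= p.1)%N && (p.2 == j p.1)).
have Yy n m : (m <= n.+1)%N -> agree (D m) y (Y n).
  move=> mn [i l] iD; rewrite /Y /=; case: andP => [[ni /eqP li]|_]; last by rewrite addbF.
  have [_ /negP[]] := jP i; rewrite -li; apply: D_le iD.
  by apply: leq_trans mn _.
have YS n : flips [:: (n, j n)] (Y n) = Y n.+1.
  apply/funext => -[i l]; rewrite /flips /Y /= addn0 xpair_eqE [n == i]eq_sym.
  rewrite [j n == l]eq_sym -addbA; congr (_ (+) _).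
  by have [->|ni] := eqVneq n i; rewrite ?ltnn ?leqnn ?eqxx ?addbb ?ltn_neqAle 1?ni ?addbF//=;
    case: eqP.
have flipY n : flips (s n) (Y n) = Y 0%N.
  elim: n => [|n IH]; first by apply/funext => i; rewrite /flips /s f0 addbF.
  have [-> _ _] := jP n; rewrite -YS flips_cat -[_ ++ _]/([:: (n, j n)] ++ (s n ++ [:: (n, j n)])).
  rewrite -IH; apply/funext => i; rewrite /flips !count_cat !oddD; congr (_ (+) _).
  by rewrite addbC -addbA addbb addbF.
have My : ~ M y.
  by move=> /MN[k]; have [_ _ _ /(_ y (yP _)) []] := fS k.
(* [Y k] lies in the box of stage [k.+1], and the flips listed at stage [k] carry it to [Y 0], hence
   outside [N k]. *)
have MY0 : ~ M (Y 0%N).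
  move=> /MN[k]; have [_ _ _ /(_ (Y k)) []] := fS k.
    by apply: agree_trans (yP _) _; apply: Yy.
  by rewrite -/(s k) flipY.
have MY n : ~ M (Y n) by move=> ?; apply: MY0; apply: (flipM (s n)); rewrite -(flipY n) flipsK.
have step n k : `|theta (Y n.+1) k - theta (Y n) k| <= 1 / 2 ^+ n.
  rewrite -YS; have [_ _] := jP n; apply => //.
  by apply: agree_trans (yP _) _; apply: Yy.
have steps n i k : `|theta (Y (i + n)%N) k - theta (Y n) k| <= 2 / 2 ^+ n - 2 / 2 ^+ (i + n).
  elim: i => [|i IH]; first by rewrite !subrr normr0.
  have := ler_distD (theta (Y (i + n)%N) k) (theta (Y (i + n).+1) k) (theta (Y n) k).
  move: (step (i + n)%N k) IH; rewrite addSn exprS invfM mulrA divff//.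
  by set a := 2 ^+ _; lra.
(* [Y (m + n)] enters every box around [y] as [m] grows, so continuity off [M] passes the bound of
   [steps] to the limit. *)
have lim n k : `|theta y k - theta (Y n) k| <= 2 / 2 ^+ n.
  apply/ler_addgt0Pr => e e0; have [E EP] := contM k y My e e0.
  pose m := (\max_(p <- E) p.1).+1.
  have /EP/(_ (MY _)) : agree E y (Y (m + n)%N).
    move=> p pE; rewrite /Y; suff -> : (m + n <= p.1)%N = false by rewrite addbF.
    apply/negbTE; rewrite -ltnNge ltn_addr// ltnS.
    exact: (@leq_bigmax_seq _ _ predT fst).
  have := ler_distD (theta (Y (m + n)%N) k) (theta y k) (theta (Y n) k).
  have := steps n m k; have : 0 < 2 / 2 ^+ (m + n) :> R by rewrite divr_gt0// exprn_gt0.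
  lra.
have [m /(_ m (leqnn m) (j m))] : E_one (Y 0%N) y.
  apply/theta_red => e e0.
  have [|n ne] := two_over_expn_small (e / 2); first by lra.
  have /theta_red/(_ (e / 2))[|K KP] : E_one (Y 0%N) (Y n).
  - by exists n => i ni l; rewrite /Y /= ni.
  - by lra.
  exists K => k /KP h; have := ler_distD (theta (Y n) k) (theta (Y 0%N) k) (theta y k).
  by have := lim n k; rewrite [`|theta y k - _|]distrC; lra.
by rewrite /Y /= eqxx; case: (y _).
Qed.

End NoReduction.

(** * Borel sets of product spaces *)

(** The sets that contain a basic box at [x] form a filter, and this filter converges to [x]
    coordinate by coordinate. *)
Lemma nbhs_prod_topology {I : eqType} (X : I -> topologicalType)
    (x : prod_topology X) (U : set (prod_topology X)) : nbhs x U ->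
  exists (D : seq I) (V : forall i, set (X i)), (forall i, nbhs (x i) (V i)) /\
    forall y, (forall i, i \in D -> V i (y i)) -> U y.
Proof.
pose F : set_system (prod_topology X) := [set U | exists (D : seq I) (V : forall i, set (X i)),
  (forall i, nbhs (x i) (V i)) /\ forall y, (forall i, i \in D -> V i (y i)) -> U y].
have FF : Filter F.
  split.
  - by exists [::], (fun=> setT); split=> // i; apply: filterT.
  - move=> P Q [D [V [xV VP]]] [E [W [xW WQ]]]; exists (D ++ E), (fun i => V i `&` W i).
    split=> [i|y yVW]; first exact: filterI.
    by split; [apply: VP|apply: WQ] => i iD; have [] := yVW i; rewrite ?mem_cat ?iD ?orbT.
  - by move=> P Q PQ [D [V [xV VP]]]; exists D, V; split=> // y /VP /PQ.
suff : F --> x by apply.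
apply/cvg_sup => i W [B [[C oC CB] Bx] BW].
exists [:: i], (fun j => [set z | C (dfwith x j z i)]); split=> [j|y /(_ i)].
  have Cx : C (x i) by move: Bx; rewrite -CB.
  have [->|ij] := eqVneq j i.
    apply: (filterS (P := C)); first by move=> z Cz; rewrite /= dfwithin.
    exact: open_nbhs_nbhs.
  by apply: filterS filterT => z _; rewrite /= dfwithout.
by rewrite mem_head /= dfwithin => /(_ isT) Cy; apply: BW; rewrite -CB.
Qed.

Lemma baire_property_borel_preimage {I : eqType} {A : Type} {Y : topologicalType}
    (F : (I -> A) -> Y) (B : set Y) :
  (forall U z, open U -> U (F z) -> exists D, forall y, agree D z y -> U (F y)) ->
  <<s @open Y >> B -> baire_property (F @^-1` B).
Proof.
move=> Fcont; move: B; apply: smallest_sub.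
  have [b0 bC bU] := @baire_property_sigma_algebra I A.
  split=> [|B /bC|B /bU]; first by rewrite /= preimage_set0.
    by rewrite !setTD preimage_setC.
  by rewrite /= preimage_bigcup.
by move=> U oU; apply: box_open_baire_property => z; apply: Fcont.
Qed.

Lemma nbhs_ptws_agree {I : eqType} (x : {ptws I -> bool}) (U : set {ptws I -> bool}) :
  nbhs x U -> exists D, forall y, agree D x y -> U y.
Proof.
move=> /nbhs_prod_topology[D [V [xV VU]]]; exists D => y xy; apply: VU => i iD.
by rewrite -xy//; apply: nbhs_singleton.
Qed.

Lemma borel_fun_comp {X Y Z : topologicalType} (g : Y -> Z) (f : X -> Y) :
  borel_fun g -> borel_fun f -> borel_fun (g \o f).
Proof. by move=> bg bf B /bg /bf. Qed.

Lemma continuous_borel_fun {X Y : topologicalType} (f : X -> Y) :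
  continuous f -> borel_fun f.
Proof.
move=> /continuousP cf B; move: B; apply: smallest_sub; last first.
  by move=> U /cf; apply: sub_sigma_algebra.
have [b0 bC bU] := smallest_sigma_algebra setT (@open X).
split=> [|B /bC|B /bU]; first by rewrite /= preimage_set0.
  by rewrite !setTD preimage_setC.
by rewrite /= preimage_bigcup.
Qed.

Lemma borel_reducible_trans {X Y Z : topologicalType} (E : X -> X -> Prop)
    (F : Y -> Y -> Prop) (G : Z -> Z -> Prop) :
  borel_reducible E F -> borel_reducible F G -> borel_reducible E G.
Proof.
move=> [f bf fE] [g bg gF]; exists (g \o f); first exact: borel_fun_comp.
by move=> x y; rewrite fE gF.
Qed.

Lemma proj_continuous_prod {I : eqType} (X : I -> topologicalType) i :
  continuous (fun x : prod_topology X => x i).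
Proof. exact: proj_continuous. Qed.

Lemma E_one_not_reducible_c0 (R : realType) : ~ borel_reducible E_one (@RN_mod_c0 R).
Proof.
move=> [theta btheta red].
have [|M mM cM] := @continuous_off_meagre (nat * nat)%type bool R nat (fun k x => theta x k).
  move=> k q; pose S := theta @^-1` [set w | w k < ratr q].
  apply: (@baire_property_borel_preimage _ _ {ptws nat * nat -> bool} id S).
    by move=> U z oU Uz; apply: nbhs_ptws_agree; apply: open_nbhs_nbhs.
  apply: (btheta [set w | w k < ratr q]); apply: sub_sigma_algebra.
  apply: (@open_comp _ _ (fun w : {ptws nat -> R} => w k) [set r | r < ratr q]).
    by move=> w _; apply: proj_continuous_prod.
  exact: open_lt.
have [M' [mM' MM' flipM']] := flip_invariant_hull M mM.
apply: (@no_continuous_off_reduction R theta _ M') => //.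
  by move=> x y; rewrite red; apply: near0P.
move=> k x nMx e e0; have [|D DP] := cM k x _ e e0; first by move/MM'.
by exists D => y xy nMy; apply: DP => // /MM'.
Qed.

Lemma borel_setC {X : topologicalType} (A : set X) :
  <<s @open X >> A -> <<s @open X >> (~` A).
Proof. by have [_ bC _] := smallest_sigma_algebra setT (@open X); rewrite -setTD; apply: bC. Qed.

Lemma borel_bigcup {X : topologicalType} {J : countType} (A : J -> set X) :
  (forall j, <<s @open X >> (A j)) -> <<s @open X >> [set x | exists j, A j x].
Proof.
move=> bA; have [b0 _ bU] := smallest_sigma_algebra setT (@open X).
pose B n := if unpickle n is Some j then A j else set0.
suff -> : [set x | exists j, A j x] = \bigcup_n B n.
  by apply: bU => n; rewrite /B; case: unpickle.
apply/seteqP; split=> x; first by move=> [j Ax]; exists (pickle j); rewrite // /B pickleK.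
by move=> [n _]; rewrite /B; case: unpickle => // j Ax; exists j.
Qed.

Lemma borel_setI {X : topologicalType} (A B : set X) :
  <<s @open X >> A -> <<s @open X >> B -> <<s @open X >> (A `&` B).
Proof.
move=> bA bB; rewrite -[A `&` B]setCK; apply: borel_setC.
rewrite (_ : ~` _ = [set x | exists b : bool, (if b then ~` A else ~` B) x]).
  by apply: borel_bigcup => -[]; apply: borel_setC.
rewrite setCI; apply/seteqP; split=> x; first by move=> [?|?]; [exists true|exists false].
by move=> [[] ?]; [left|right].
Qed.

Lemma borel_fun_ptws {R : realType} {X : topologicalType} (f : X -> {ptws nat -> R}) :
  (forall k, borel_fun (fun x => f x k)) -> borel_fun f.
Proof.
move=> bf B; move: B; apply: smallest_sub.
  have [b0 bC bU] := smallest_sigma_algebra setT (@open X).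
  split=> [|B /bC|B /bU]; first by rewrite /= preimage_set0.
    by rewrite !setTD preimage_setC.
  by rewrite /= preimage_bigcup.
move=> U oU.
(* Cylinders with rational endpoints are coded by a countable type, and an open set is the union of
   those it contains. *)
pose cyl (c : seq (nat * rat * rat)) : set {ptws nat -> R} :=
  [set w | forall i, i \in c -> ratr i.1.2 < w i.1.1 < ratr i.2].
have bcyl c : <<s @open X >> (f @^-1` cyl c).
  elim: c => [|[[k a] b] c IH].
    rewrite (_ : _ @^-1` _ = ~` set0).
      by apply: borel_setC; have [] := smallest_sigma_algebra setT (@open X).
    by apply/seteqP; split=> [x _ []|x _ i].
  rewrite (_ : _ @^-1` _ =
      ((fun x => f x k) @^-1` [set r | ratr a < r < ratr b]) `&` (f @^-1` cyl c)).
    apply: borel_setI IH; apply: (bf k); apply: sub_sigma_algebra.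
    rewrite (_ : [set r | _] = [set` `]ratr a, ratr b[%R]); first exact: itv_open.
    by apply/seteqP; split=> r /=; rewrite in_itv.
  apply/seteqP; split=> x /=.
    move=> fx; split; first by apply: (fx (k, a, b)); rewrite mem_head.
    by move=> i ic; apply: fx; rewrite in_cons ic orbT.
  by move=> [fk fc] i; rewrite in_cons => /predU1P[->|/fc].
rewrite (_ : f @^-1` U = [set x | exists c,
    (if `[< cyl c `<=` U >] then f @^-1` cyl c else set0) x]).
  apply: borel_bigcup => c; case: asboolP => _ //.
  by have [] := smallest_sigma_algebra setT (@open X).
apply/seteqP; split=> x /=; last by move=> [c]; case: asboolP => // cU /cU.
move=> Ufx; have [D [V [fV VU]]] : exists (D : seq nat) (V : nat -> set R),
    (forall i, nbhs (f x i) (V i)) /\ forall y, (forall i, i \in D -> V i (y i)) -> U y.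
  by apply: (@nbhs_prod_topology nat (fun=> R)); apply: open_nbhs_nbhs.
have /choice[c cP] i : exists c : rat * rat, ratr c.1 < f x i < ratr c.2 /\
    forall r : R, ratr c.1 < r < ratr c.2 -> V i r.
  have /nbhs_ballP[e /= e0 eV] := fV i.
  have [|a] := @rat_in_itvoo _ (f x i - e) (f x i); first by lra.
  have [|b] := @rat_in_itvoo _ (f x i) (f x i + e); first by lra.
  rewrite !in_itv /= => /andP[b1 b2] /andP[a1 a2]; exists (a, b); split=> /=; first by rewrite a2.
  move=> r /andP[ar rb]; apply: eV; rewrite /ball /= ltr_norml; apply/andP; split; lra.
exists [seq (i, (c i).1, (c i).2) | i <- D].
have cU : cyl [seq (i, (c i).1, (c i).2) | i <- D] `<=` U.
  move=> w wc; apply: VU => i iD; have [_] := cP i; apply.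
  by apply: (wc (i, (c i).1, (c i).2)); apply/mapP; exists i.
case: asboolP => // _ _ /mapP[i iD ->] /=.
by have [] := cP i.
Qed.

(** * Reduction to [RN_mod_c0] *)

Section Bump.
Context {R : realType}.
Implicit Types (r e : R) (w : nat -> R).

Fixpoint capped_min r k w :=
  if k is k'.+1 then Num.min (capped_min r k' w) (w k') else 2 * r.

(* Applied to [w k = d u (s k)], the functions [bump r k] are 1-Lipschitz in [u],
   supported in the ball of radius [3 r] at [s k], and only finitely many of them
   are nonzero at a given [u], as [capped_min] drops below [r]. *)
Definition bump r k w :=
  Num.min r (Num.min (Num.max 0 (capped_min r k w - r)) (Num.max 0 (3 * r - w k))).

Let dist_min e (a b a' b' : R) : `|a - a'| <= e -> `|b - b'| <= e ->
  `|Num.min a b - Num.min a' b'| <= e.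
Proof.
rewrite !ler_norml => /andP[? ?] /andP[? ?]; apply/andP.
by case: (leP a b) => ?; case: (leP a' b') => ?; split; lra.
Qed.

Let dist_max e (a b a' b' : R) : `|a - a'| <= e -> `|b - b'| <= e ->
  `|Num.max a b - Num.max a' b'| <= e.
Proof.
rewrite !ler_norml => /andP[? ?] /andP[? ?]; apply/andP.
by case: (leP a b) => ?; case: (leP a' b') => ?; split; lra.
Qed.

Lemma bump_lipschitz r k w w' e : (forall i, `|w i - w' i| <= e) ->
  `|bump r k w - bump r k w'| <= e.
Proof.
move=> ww'; have e0 : 0 <= e by apply: le_trans (ww' 0%N).
have h : `|capped_min r k w - capped_min r k w'| <= e.
  by elim: k => [|k IH] /=; rewrite ?subrr ?normr0//; apply: dist_min.
apply: dist_min; first by rewrite subrr normr0.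
apply: dist_min; apply: dist_max; rewrite ?subrr ?normr0//.
  by rewrite (_ : _ - _ = capped_min r k w - capped_min r k w')//; lra.
by rewrite (_ : _ - _ = w' k - w k); [rewrite distrC|lra].
Qed.

Lemma bump_eventually0 r w k : 0 < r -> w k < r ->
  forall i, (k < i)%N -> bump r i w = 0.
Proof.
move=> r0 wk i ki; have : capped_min r i w <= r.
  elim: i ki => // i IH; rewrite ltnS leq_eqVlt => /predU1P[<-|/IH] /=.
    by rewrite ge_min (ltW wk) orbT.
  by rewrite ge_min => ->.
move=> h; rewrite /bump [Num.max 0 (_ - r)]max_l; last by lra.
by rewrite [Num.min 0 _]min_l ?le_max ?lexx// min_r// ltW.
Qed.

(** Take the least [i] with [w i < 2 * r]: there [capped_min] still has its cap [2 * r] and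
    [3 * r - w i > r], so the bump of [w] equals [r], while [3 * r <= w' i] kills the bump of
    [w']. *)
Lemma bump_separates r w w' k : 0 < r -> w k < 2 * r ->
  (forall i, w i < 2 * r -> 3 * r <= w' i) ->
  exists i, bump r i w - bump r i w' = r.
Proof.
move=> r0 wk ww'.
have [i wi imin] := ex_minnP (ex_intro (fun k => w k < 2 * r) k wk).
exists i; have -> : bump r i w' = 0.
  rewrite /bump [Num.max 0 (3 * _ - _)]max_l; last by have := ww' i wi; lra.
  by rewrite [Num.min _ 0]min_r ?le_max ?lexx// min_r// ltW.
have -> : bump r i w = r; last by rewrite subr0.
suff h : capped_min r i w = 2 * r.
  rewrite /bump h min_l// le_min !le_max; apply/andP; split; apply/orP; right; lra.
have : forall j, (j < i)%N -> 2 * r <= w j.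
  by move=> j ji; rewrite leNgt; apply/negP => /imin; rewrite leqNgt ji.
elim: {wi imin} i => [//|i IH h] /=.
by rewrite IH => [|j /ltnW/h//]; rewrite min_l// h.
Qed.

Let continuousB {T : topologicalType} (f g : T -> R) :
  continuous f -> continuous g -> continuous (fun x => f x - g x).
Proof. by move=> cf cg x; apply: cvgB; [apply: cf|apply: cg]. Qed.

Let continuous_minimum {T : topologicalType} (f g : T -> R) :
  continuous f -> continuous g -> continuous (fun x => Num.min (f x) (g x)).
Proof. by move=> cf cg x; apply: (continuous_min (cf x) (cg x)). Qed.

Let continuous_maximum {T : topologicalType} (f g : T -> R) :
  continuous f -> continuous g -> continuous (fun x => Num.max (f x) (g x)).
Proof. by move=> cf cg x; apply: (continuous_max (cf x) (cg x)). Qed.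

Let continuous_const {T : topologicalType} (c : R) : continuous (fun _ : T => c).
Proof. by move=> x; apply: cvg_cst. Qed.

Lemma bump_continuous r k : continuous (bump r k : {ptws nat -> R} -> R).
Proof.
have pc i : continuous (fun w : {ptws nat -> R} => w i) by exact: proj_continuous_prod.
have cc : continuous (capped_min r k : {ptws nat -> R} -> R).
  by elim: k => [|k IH]; [exact: continuous_const|exact: continuous_minimum].
apply: continuous_minimum; first exact: continuous_const.
by apply: continuous_minimum; apply: continuous_maximum;
  first [exact: continuous_const|apply: continuousB => //; exact: continuous_const].
Qed.

End Bump.

(** Separability passes to larger radii, so an infimum below [e] gives [e]-separability. Conversely
    [e / 2] keeps the infimum strictly inside the [e]-neighbourhood. *)
Lemma delta_of_cvg0P (R : realType) (X : nat -> Type) (d : forall n, X n -> X n -> R) :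
  (fun n => delta_of (d n)) @ \oo --> (0%E : \bar R) <->
  forall e : R, 0 < e -> exists N, forall n, (N <= n)%N -> delta_separable (d n) e.
Proof.
split=> [d0 e e0|dsep].
  have /d0[N _ NP] : nbhs (0%E : \bar R) [set x | (x < e%:E)%E].
    by apply: open_nbhs_nbhs; split; [exact: open_ereal_lt_ereal|rewrite /= lte_fin].
  exists N => n /NP /ereal_inf_lt[_ [e' [_ [S cS SP]] <-]]; rewrite lte_fin => e'e.
  by exists S => // u; have [s Ss /lt_trans us] := SP u; exists s => //; apply: us.
move=> U U0; have /nbhs_ballP[e /= e0 eU] : nbhs (0 : R) (fun r => U r%:E) by [].
have [|N NP] := dsep (e / 2); first by lra.
exists N => // n /= /NP sep.
have dle : (delta_of (d n) <= (e / 2)%:E)%E.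
  by apply: ereal_inf_lbound; exists (e / 2) => //; split=> //; lra.
have dge : (0 <= delta_of (d n))%E.
  by apply/ereal_infP => _ [r [/ltW r0 _] <-]; rewrite lee_fin.
case: (delta_of (d n)) dle dge => //= r; rewrite !lee_fin => re r0.
by apply: eU; rewrite /ball /= sub0r normrN ger0_norm//; lra.
Qed.

Lemma countable_enumeration {T : Type} (S : set T) (x0 : T) : countable S ->
  exists g : nat -> T, forall x, S x -> exists k, g k = x.
Proof.
move=> /countable_injP[f finj].
have /choice[g gP] k : exists y, forall x, S x -> f x = k -> y = x.
  have [[x Sx fx]|no] := pselect (exists2 x, S x & f x = k).
    by exists x => y Sy fy; apply: finj; rewrite ?inE// fx.
  by exists x0 => x Sx fx; case: no; exists x.
by exists g => x Sx; exists (f x); apply: gP.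
Qed.

Lemma E_zero_reducible_c0 (R : realType) (X : nat -> topologicalType)
    (d : forall n : nat, X n -> X n -> R) :
  (forall n, borel_pseudo_metric (d n)) -> (forall n, [set: X n] !=set0) ->
  (forall e : R, 0 < e -> exists N, forall n, (N <= n)%N -> delta_separable (d n) e) ->
  borel_reducible (E_zero d) (@RN_mod_c0 R).
Proof.
move=> bd X0 dsep; pose r (j : nat) : R := 2^-1 ^+ j.
have r0 j : 0 < r j by rewrite exprn_gt0.
have r_small e : 0 < e -> exists j, r j < e.
  move=> /two_over_expn_small[n ne]; exists n; rewrite /r exprVn.
  by move: ne (r0 n); rewrite /r exprVn; set x := _^-1; lra.
have sex n j : {s : nat -> X n | delta_separable (d n) (r j) ->
    forall u, exists k, d n u (s k) < r j}.
  apply: cid; have [x0 _] := X0 n.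
  have [[S cS SP]|] := pselect (delta_separable (d n) (r j)); last by exists (fun=> x0).
  have [g gP] := countable_enumeration S x0 cS.
  by exists g => _ u; have [y /gP[k <-] uy] := SP u; exists k.
pose s n j := sval (sex n j).
have sP n j : delta_separable (d n) (r j) -> forall u, exists k, d n u (s n j k) < r j.
  by rewrite /s; case: (sex n j).
(* The bound [j <= n] leaves finitely many scales for each [n], so each [n] contributes finitely
   many nonzero coordinates at a given point. *)
pose active n j := (j <= n)%N && `[< delta_separable (d n) (r j) >].
pose T n j k (u : X n) := if active n j then bump (r j) k (fun i => d n u (s n j i)) else 0.
pose theta (x : prod_topology X) : {ptws nat -> R} := fun l =>
  if @pickle_inv (nat * nat * nat)%type l is Some (n, j, k) then T n j k (x n) else 0.
have bconst (c : R) : borel_fun (fun _ : prod_topology X => c).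
  by apply: continuous_borel_fun; exact: cst_continuous.
have Tlip n j k u v : `|T n j k u - T n j k v| <= d n u v.
  have [[dge0 _ dC dtri] _] := bd n.
  rewrite /T; case: (active n j); last by rewrite subrr normr0.
  apply: bump_lipschitz => i; rewrite ler_norml.
  have := dtri u v (s n j i); have := dtri v u (s n j i); rewrite (dC v u) => ? ?.
  by apply/andP; split; lra.
have T0 n j u : exists K, forall k, (K <= k)%N -> T n j k u = 0.
  rewrite /T /active; case: asboolP; last by exists 0%N => k _; rewrite andbF.
  move=> /sP/(_ u)[k uk]; exists k.+1 => i ki; case: ifP => // _.
  exact: bump_eventually0 ki.
(* If [d u s < 2 r] and [d u v >= 5 r], then [d v s >= 3 r], as [bump_separates] requires. *)
have Tsep n j u v : active n j -> 5 * r j <= d n u v ->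
    exists k, r j <= `|T n j k u - T n j k v|.
  move=> /[dup] act /andP[_ /asboolP/sP uS] uv; have [[_ _ dC dtri] _] := bd n.
  have [k uk] := uS u; have [||i ui] := @bump_separates R (r j)
    (fun i => d n u (s n j i)) (fun i => d n v (s n j i)) k (r0 j).
  - by have := r0 j; lra.
  - by move=> i; have := dtri u (s n j i) v; rewrite (dC (s n j i) v); lra.
  by exists i; rewrite /T act ui ger0_norm// ltW.
exists theta.
  apply: borel_fun_ptws => l; rewrite /theta; case: pickle_inv => [[[n j] k]|]; last exact: bconst.
  rewrite /T; case: (active n j); last exact: bconst.
  apply: (@borel_fun_comp _ {ptws nat -> R} _ (bump (r j) k)
    (fun x : prod_topology X => fun i => d n (x n) (s n j i))).
    by apply: continuous_borel_fun; exact: bump_continuous.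
  apply: borel_fun_ptws => i; have [_ bdn] := bd n.
  apply: (borel_fun_comp _ (fun x : prod_topology X => (x n, s n j i)) bdn).
  apply: continuous_borel_fun => x.
  have xn : (fun z : prod_topology X => z n) @ x --> x n by exact: proj_continuous_prod.
  have sn : (fun _ : prod_topology X => s n j i) @ x --> s n j i by exact: cst_continuous.
  exact: cvg_pair xn sn.
move=> x y; rewrite /E_zero /RN_mod_c0 !near0P; split=> xy e e0.
  have [N NP] := xy e e0.
  have /choice[K KP] (p : nat * nat) : exists K, forall k, (K <= k)%N ->
      T p.1 p.2 k (x p.1) = 0 /\ T p.1 p.2 k (y p.1) = 0.
    have [K1 K1P] := T0 p.1 p.2 (x p.1); have [K2 K2P] := T0 p.1 p.2 (y p.1).
    by exists (maxn K1 K2) => k; rewrite geq_max => /andP[/K1P ? /K2P ?].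
  (* For [n >= N] the Lipschitz bound suffices; [B] lists the codes of the remaining coordinates
     that may be nonzero. *)
  pose B := [seq pickle (p.1, p.2, k) | p <- [seq (n, j) | n <- iota 0 N, j <- iota 0 N],
    k <- iota 0 (K p)].
  exists (\max_(l <- B) l).+1 => l Bl; rewrite /theta.
  case El : pickle_inv => [[[n j] k]|]; last by rewrite subrr normr0.
  have [Nn|nN] := leqP N n.
    by apply: le_lt_trans (Tlip _ _ _ _ _) (le_lt_trans (ler_norm _) (NP n Nn)).
  have [nj|jn] := ltnP n j; first by rewrite /T /active leqNgt nj subrr normr0.
  have [/(KP (n, j))[/= -> ->]|kK] := leqP (K (n, j)) k; first by rewrite subrr normr0.
  have lB : l \in B.
    apply/allpairsPdep; exists (n, j), k; split=> //.
    - by apply/allpairsP; exists (n, j); rewrite !mem_iota/= nN (leq_ltn_trans jn).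
    - by rewrite mem_iota.
    by have := @pickle_invK (nat * nat * nat)%type l; rewrite El.
  by have := @leq_bigmax_seq _ _ predT id l lB isT; rewrite leqNgt Bl.
have [|j je] := r_small (e / 5); first by lra.
have [N0 N0P] := dsep (r j) (r0 j).
have [K KP] := xy (r j) (r0 j).
(* Beyond every [n] that occurs in a code below [K], the code of [(n, j, k)] is at least [K]
   whatever [k] is. *)
exists (maxn (maxn N0 j) (\max_(l <- iota 0 K) (if @pickle_inv (nat * nat * nat)%type l
  is Some (n, _, _) then n else 0%N)).+1) => n.
rewrite !geq_max => /andP[/andP[/N0P nsep jn] nK].
have [[dge0 _ _ _] _] := bd n; rewrite ger0_norm// ltNge; apply/negP => dxy.
have act : active n j by rewrite /active jn; apply/asboolP.
have [|k kT] := Tsep n j (x n) (y n) act; first by lra.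
pose l := pickle (n, j, k).
have [Kl|lK] := leqP K l.
  by have := KP l Kl; rewrite /theta /l pickleK_inv ltNge kT.
have := @leq_bigmax_seq _ (iota 0 K) predT (fun l => if @pickle_inv (nat * nat * nat)%type l
  is Some (n, _, _) then n else 0%N) l.
by rewrite mem_iota lK /= /l pickleK_inv leqNgt nK => /(_ isT isT).
Qed.

(** * Separated Cantor sets in non-separable Borel pseudo-metric spaces *)

Definition metric_cvg {R : realType} {X : Type} (rho : X -> X -> R) (u : nat -> X) (x : X) :=
  forall e : R, 0 < e -> exists N, forall n, (N <= n)%N -> rho x (u n) < e.

(** Convergence in the Baire space. *)
Definition eventually_eq (w_ : nat -> nat -> nat) (w : nat -> nat) :=
  forall i, exists N, forall n, (N <= n)%N -> w_ n i = w i.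

(** Membership is asked only eventually: in the Cantor scheme the approximations satisfy [K] from
    some level on. *)
Definition sequentially_closed {R : realType} {X : Type} (rho : X -> X -> R)
    (K : X -> X -> (nat -> nat) -> Prop) :=
  forall (x_ y_ : nat -> X) (w_ : nat -> nat -> nat) x y w,
    metric_cvg rho x_ x -> metric_cvg rho y_ y -> eventually_eq w_ w ->
    (exists N, forall n, (N <= n)%N -> K (x_ n) (y_ n) (w_ n)) -> K x y w.

(** * Analytic sets in the square of a metric space *)

Section Souslin.
Context {R : realType} {X : topologicalType}.
Variable rho : X -> X -> R.
Hypothesis metric_rho : metric rho.
Hypothesis metrizes_rho : metrizes rho.

Let rhoC x y : rho x y = rho y x.
Proof. by have [[_ _ h _] _] := metric_rho. Qed.

Let rho_tri x y z : rho x z <= rho x y + rho y z.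
Proof. by have [[_ _ _ h] _] := metric_rho. Qed.

(* [B] is the projection along Baire space of a closed set, that is, analytic. *)
Definition souslin (B : set (X * X)) := exists2 K, sequentially_closed rho K &
  forall x y, B (x, y) <-> exists w, K x y w.

(** One witness codes, through pairing, a witness for each [B n]. *)
Lemma souslin_bigcap (B : nat -> set (X * X)) :
  (forall n, souslin (B n)) -> souslin (\bigcap_n B n).
Proof.
move=> sB; have /choice[K KP] n : exists K, sequentially_closed rho K /\
  forall x y, B n (x, y) <-> exists w, K x y w by have [K ? ?] := sB n; exists K.
exists (fun x y w => forall i, K i x y (fun k => w (pickle (i, k)))).
  move=> x_ y_ w_ x y w xx yy ww [N NP] i; have [Kc _] := KP i.
  apply: (Kc x_ y_ (fun n k => w_ n (pickle (i, k)))) => //.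
  by exists N => n /NP; apply.
move=> x y; split=> [Bxy|[w wK] i _].
  have /choice[w wP] i : exists w, K i x y w by have [_ h] := KP i; apply/h/Bxy.
  exists (fun l => if @unpickle (nat * nat)%type l is Some (i, k) then w i k else 0%N) => i.
  by under eq_fun do rewrite pickleK.
by have [_ h] := KP i; apply/h; exists (fun k => w (pickle (i, k))).
Qed.

(** The first entry of the witness selects the set; it is eventually constant along a convergent
    sequence of witnesses. *)
Lemma souslin_bigcup (B : nat -> set (X * X)) :
  (forall n, souslin (B n)) -> souslin (\bigcup_n B n).
Proof.
move=> sB; have /choice[K KP] n : exists K, sequentially_closed rho K /\
  forall x y, B n (x, y) <-> exists w, K x y w by have [K ? ?] := sB n; exists K.
exists (fun x y w => K (w 0%N) x y (fun k => w k.+1)).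
  move=> x_ y_ w_ x y w xx yy ww [N NP]; have [Kc _] := KP (w 0%N).
  apply: (Kc x_ y_ (fun n k => w_ n k.+1)) => //.
  have [N' N'P] := ww 0%N; exists (maxn N N') => n; rewrite geq_max => /andP[/NP + /N'P h].
  by rewrite h.
move=> x y; split=> [[i _ Bxy]|[w wK]].
  have [_ /(_ x y)[/(_ Bxy)[w wK] _]] := KP i.
  by exists (fun k => if k is k'.+1 then w k' else i).
by exists (w 0%N) => //; have [_ h] := KP (w 0%N); apply/h; exists (fun k => w k.+1).
Qed.

Let open_ball2 (U : set (X * X)) x y : open U -> U (x, y) -> exists2 e : R, 0 < e &
  forall x' y', rho x x' < e -> rho y y' < e -> U (x', y').
Proof.
move=> oU Uxy; have [[P Q] /= [/metrizes_rho[e1 e10 e1P] /metrizes_rho[e2 e20 e2Q]] PQ] :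
  nbhs (x, y) U by apply: open_nbhs_nbhs.
exists (Num.min e1 e2); first by rewrite lt_min e10.
move=> x' y'; rewrite !lt_min => /andP[xe _] /andP[_ ye].
by apply: (PQ (x', y')); split; [apply: e1P|apply: e2Q].
Qed.

(** An open set is a countable union of closed sets: the first entry of the witness bounds from
    below the radius of a ball inside [U]. *)
Lemma souslin_open (U : set (X * X)) : open U -> souslin U.
Proof.
move=> oU.
exists (fun x y w => forall x' y', rho x x' < (w 0%N).+1%:R^-1 ->
    rho y y' < (w 0%N).+1%:R^-1 -> U (x', y')).
  move=> x_ y_ w_ x y w xx yy ww [N NP] x' y'.
  move Ea: (w 0%N).+1%:R^-1 => a xx' yy'; have [N1 N1P] := ww 0%N.
  have [|N2 N2P] := xx (a - rho x x'); first by lra.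
  have [|N3 N3P] := yy (a - rho y y'); first by lra.
  pose n := maxn (maxn N N1) (maxn N2 N3).
  have := leqnn n; rewrite {1}/n !geq_max => /andP[/andP[nN n1] /andP[n2 n3]].
  apply: (NP n nN); rewrite N1P// Ea.
    by have := rho_tri (x_ n) x x'; have := N2P n n2; rewrite (rhoC (x_ n) x); lra.
  by have := rho_tri (y_ n) y y'; have := N3P n n3; rewrite (rhoC (y_ n) y); lra.
move=> x y; have rho0 z : rho z z = 0 by have [[_ h _ _] _] := metric_rho.
split=> [/(open_ball2 _ _ _ oU)[e e0 eU]|[w wU]]; last by apply: wU; rewrite rho0 invr_gt0.
have [k _ ke] := near_infty_natSinv_lt (PosNum e0).
exists (fun=> k) => x' y' xk yk.
by have h := ke k (leqnn k); apply: eU; [apply: lt_trans xk h|apply: lt_trans yk h].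
Qed.

Lemma souslin_setC_open (U : set (X * X)) : open U -> souslin (~` U).
Proof.
move=> oU; exists (fun x y w => ~ U (x, y)).
  move=> x_ y_ w_ x y w xx yy ww [N NP] /(open_ball2 _ _ _ oU)[e e0 eU].
  have [N2 N2P] := xx e e0; have [N3 N3P] := yy e e0.
  pose n := maxn N (maxn N2 N3).
  have := leqnn n; rewrite {1}/n !geq_max => /and3P[nN n2 n3].
  by apply: (NP n nN); apply: eU; [apply: N2P|apply: N3P].
by move=> x y; split=> [Uxy|[]//]; exists (fun=> 0%N).
Qed.

(** Analytic sets are not stable under complement, so the induction carries the set together with
    its complement. *)
Lemma souslin_borel (B : set (X * X)) : <<s @open (X * X)%type >> B -> souslin B.
Proof.
suff h : <<s @open (X * X)%type >> `<=` [set B | souslin B /\ souslin (~` B)].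
  by move=> /h[].
apply: smallest_sub.
  split.
  - split; [|rewrite setC0]; apply: souslin_open; [exact: open0|exact: openT].
  - by move=> A [sA sCA]; split; rewrite setTD ?setCK.
  move=> A sA; split; first by apply: souslin_bigcup => n; have [] := sA n.
  by rewrite setC_bigcup; apply: souslin_bigcap => n; have [] := sA n.
by move=> U oU; split; [apply: souslin_open|apply: souslin_setC_open].
Qed.

End Souslin.

(** * Fusion along binary strings *)

Fixpoint rev_prefix (a : nat -> bool) n : seq bool :=
  if n is n'.+1 then a n' :: rev_prefix a n' else [::].

Lemma size_rev_prefix a n : size (rev_prefix a n) = n.
Proof. by elim: n => //= n ->. Qed.

Lemma eq_rev_prefix a b n : (forall i, (i < n)%N -> a i = b i) ->
  rev_prefix a n = rev_prefix b n.
Proof. by elim: n => //= n IH h; rewrite h// IH// => i /ltnW/h. Qed.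

Lemma rev_prefix_inj a b n : rev_prefix a n = rev_prefix b n ->
  forall i, (i < n)%N -> a i = b i.
Proof.
elim: n => //= n IH [anbn /IH h] i; rewrite ltnS leq_eqVlt.
by move=> /predU1P[->|/h].
Qed.

Definition strings n : seq (seq bool) := [seq val t | t <- enum {: n.-tuple bool}].

Lemma mem_strings n s : size s = n -> s \in strings n.
Proof.
by move=> /eqP sn; apply/mapP; exists (Tuple sn); rewrite ?mem_enum.
Qed.

Section CantorScheme.
Context {R : realType} {X : Type}.
Variables (rho d : X -> X -> R) (q : nat -> X) (eps : R).
Variable K : X -> X -> (nat -> nat) -> Prop.
Hypothesis rho_metric : pseudo_metric rho.
Hypothesis rho_complete :
  forall u, cauchy_for rho u -> exists x, metric_cvg rho u x.
Hypothesis q_dense : forall x (e : R), 0 < e -> exists k, rho x (q k) < e.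
Hypothesis d_metric : pseudo_metric d.
Hypothesis K_closed : sequentially_closed rho K.
Hypothesis K_far : forall x y, eps <= d x y <-> exists w, K x y w.
Hypothesis not_sep : ~ delta_separable d eps.

(* A configuration at level [n] assigns points to the binary strings of length [n],
   with witnesses that the points are [eps]-apart; strings are written backwards,
   and values at strings of other lengths are irrelevant. *)
Let config := ((seq bool -> X) * (seq bool -> seq bool -> nat -> nat))%type.

(** Positivity for the sigma-ideal generated by the sets of configurations with some point in a
    countable union of [eps]-balls. *)
Let nonsmall n (P : set config) := forall (J : countType) (a : J -> X),
  exists2 c, P c & forall s, size s = n -> forall j, eps <= d (c.1 s) (a j).

Let valid n (c : config) := forall s t, size s = n -> size t = n -> s <> t ->
  K (c.1 s) (c.1 t) (c.2 s t).

Let good n P := nonsmall n P /\ forall c, P c -> valid n c.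

Let extends n (P P' : set config) := forall c, P' c -> forall b, exists2 c0, P c0 &
  (forall s, size s = n -> c.1 (b :: s) = c0.1 s) /\
  (forall s t, size s = n -> size t = n -> c.2 (b :: s) (b :: t) = c0.2 s t).

Let narrow n (P : set config) := forall c c', P c -> P c' ->
  (forall s, size s = n.+1 -> rho (c.1 s) (c'.1 s) <= 1 / 2 ^+ n) /\
  (forall s t, size s = n.+1 -> size t = n.+1 -> forall i, (i <= n)%N ->
    c.2 s t i = c'.2 s t i).

(** If every piece of a countable partition were small, the disjoint union of the countable families
    witnessing it would show that [P] is small. *)
Let nonsmall_refine {T : countType} n P (l : config -> T) :
  nonsmall n P -> exists a, nonsmall n [set c | P c /\ l c = a].
Proof.
move=> nP; apply: contrapT => nex.
have /choice[f fP] a : exists J : {J : countType & J -> X}, ~ exists2 c,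
    P c /\ l c = a & forall s, size s = n -> forall j, eps <= d (c.1 s) (projT2 J j).
  apply: contrapT => no; apply: nex; exists a => J f; apply: contrapT => h.
  by apply: no; exists (existT _ J f).
have [c Pc cf] := nP {a : T & projT1 (f a)} (fun u => projT2 (f (projT1 u)) (projT2 u)).
apply: (fP (l c)); exists c => // s sn j.
exact: (cf s sn (existT _ (l c) j)).
Qed.

(** Choose [c0] in [P] far from [a], then [c1] in [P] far from [a] and from all points of [c0]; they
    become the halves [false] and [true]. Cross distances are at least [eps], and [K_far] supplies
    witnesses in both orders, as [K] need not be symmetric. *)
Let amalgamate n P : good n P -> exists2 P', good n.+1 P' & extends n P P'.
Proof.
have [_ _ dC _] := d_metric.
move=> [nP vP]; have [x0 _] : exists x : X, True.
  by have [c _ _] := nP void (fun v => match v with end); exists (c.1 [::]).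
exists [set c | valid n.+1 c /\ forall b, exists2 c0, P c0 &
  (forall s, size s = n -> c.1 (b :: s) = c0.1 s) /\
  (forall s t, size s = n -> size t = n -> c.2 (b :: s) (b :: t) = c0.2 s t)]; last by move=> c [].
split=> [|c []//] J a.
have [c0 Pc0 c0a] := nP J a.
have [c1 Pc1 c1a] := nP (J + seq bool)%type
  (fun j => match j with inl j => a j | inr s => c0.1 s end).
have /choice[W1 W1P] (p : seq bool * seq bool) : exists w, size p.1 = n ->
    K (c1.1 p.1) (c0.1 p.2) w.
  have [pn|] := eqVneq (size p.1) n; last by move=> /eqP; exists (fun=> 0%N).
  by have /K_far[w] := c1a p.1 pn (inr p.2); exists w.
have /choice[W0 W0P] (p : seq bool * seq bool) : exists w, size p.1 = n ->
    K (c0.1 p.2) (c1.1 p.1) w.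
  have [pn|] := eqVneq (size p.1) n; last by move=> /eqP; exists (fun=> 0%N).
  by have := c1a p.1 pn (inr p.2); rewrite dC => /K_far[w]; exists w.
pose cb (b : bool) := if b then c1 else c0.
pose c : config := (fun u => if u is b :: s then (cb b).1 s else x0,
  fun u v => match u, v with
    | b :: s, b' :: t => if b == b' then (cb b).2 s t else if b then W1 (s, t) else W0 (t, s)
    | _, _ => fun=> 0%N end).
exists c.
  split.
    move=> [|b s] [|b' t] //= [sn] [tn] st; rewrite /c /=.
    case: eqP => [bb'|]; last by case: b b' {st} => -[] neq;
      first [by case: neq | exact: (W1P (s, t)) | exact: (W0P (t, s))].
    rewrite -bb'; have : valid n (cb b) by case: b {st bb'}; apply: vP.
    by apply=> // eqst; apply: st; rewrite bb' eqst.
  move=> b; exists (cb b); first by case: b.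
  by split=> // s t _ _; rewrite /c /= eqxx.
move=> [|b s] //= [sn] j; case: b => /=; last exact: c0a.
exact: (c1a s sn (inl j)).
Qed.

(** Colour a configuration by nearby points of the dense sequence and by initial segments of the
    witnesses. There are countably many colours, so one class is not small. *)
Let refine_good n P : good n.+1 P -> exists P', [/\ good n.+1 P', P' `<=` P & narrow n P'].
Proof.
have [_ _ rhoC rho_tri] := rho_metric.
have e0 : 0 < 1 / 2 ^+ n.+1 :> R by rewrite divr_gt0// exprn_gt0.
have /choice[k kP] x : exists k, rho x (q k) < 1 / 2 ^+ n.+1 by apply: q_dense.
pose S := strings n.+1.
move=> [nP vP]; have [a aP] := nonsmall_refine n.+1 P (fun c : config =>
  ([seq k (c.1 s) | s <- S],
   [seq [seq [seq c.2 s t i | i <- iota 0 n.+1] | t <- S] | s <- S])) nP.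
exists [set c | P c /\ ([seq k (c.1 s) | s <- S],
   [seq [seq [seq c.2 s t i | i <- iota 0 n.+1] | t <- S] | s <- S]) = a]; split.
- by split=> // c [/vP].
- by move=> c [].
move=> c c' [_ <-] [_ [/eq_in_map h1 /eq_in_map h2]]; split=> [s sn|s t sn tn i ni].
  have h := h1 s (mem_strings _ _ sn).
  have := rho_tri (c.1 s) (q (k (c.1 s))) (c'.1 s); rewrite [rho (q _) _]rhoC.
  have := kP (c.1 s); have := kP (c'.1 s); rewrite h.
  have -> : 1 / 2 ^+ n = 1 / 2 ^+ n.+1 + 1 / 2 ^+ n.+1 :> R.
    by rewrite exprS invfM; set x := (2 ^+ n)^-1; lra.
  set r := 1 / _; lra.
have /eq_in_map h := h2 s (mem_strings _ _ sn).
have hi : [seq c'.2 s t i | i <- iota 0 n.+1] = [seq c.2 s t i | i <- iota 0 n.+1].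
  exact: h t (mem_strings _ _ tn).
by move/eq_in_map: hi => -> //; rewrite mem_iota.
Qed.

Lemma cantor_scheme : exists f : (nat -> bool) -> X,
  (forall n a b, (forall i, (i <= n)%N -> a i = b i) -> rho (f a) (f b) <= 4 / 2 ^+ n) /\
  (forall m a b, (forall i, (m <= i)%N -> a i = b i) -> a <> b -> eps <= d (f a) (f b)).
Proof.
have [rho_ge0 rho0 rhoC rho_tri] := rho_metric.
have [||P [_ Pgood PS]] := @dependent_choice_nat (set config) good
  (fun n P P' => extends n P P' /\ narrow n P') setT.
(* Level 0 has a single string, so validity is vacuous and [nonsmall] is exactly the failure of
   [eps]-separability. *)
- split=> [J a|c _ [|//] [|//]//].
  apply: contrapT => no; apply: not_sep; exists (range a).
    exact: card_le_trans (card_image_le _ _) (countableP _).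
  move=> u; apply: contrapT => nu; apply: no; exists (fun=> u, fun _ _ _ => 0%N) => // s _ j.
  by rewrite leNgt; apply/negP => uj; apply: nu; exists (a j) => //; exists j.
- move=> n P /amalgamate[P' /refine_good[P'' [gP'' P''P' nP'']] eP'].
  by exists P'' => //; split=> // c /P''P' /eP'.
have /choice[c cP] n : exists c, P n c.
  by have [/(_ void (fun v => match v with end))[c]] := Pgood n; exists c.
pose x a n := (c n).1 (rev_prefix a n).
have step a n : rho (x a n.+1) (x a n.+2) <= 1 / 2 ^+ n.
  have [ex _] := PS n.+1; have [c0 Pc0 [h _]] := ex _ (cP n.+2) (a n.+1).
  rewrite /x -[rev_prefix a n.+2]/(a n.+1 :: rev_prefix a n.+1) h ?size_rev_prefix//.
  by have [_ /(_ _ _ (cP n.+1) Pc0)[+ _]] := PS n; apply; rewrite size_rev_prefix.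
have steps a n i : rho (x a n.+1) (x a (i + n).+1) <= 2 / 2 ^+ n - 2 / 2 ^+ (i + n).
  elim: i => [|i IH]; first by rewrite rho0 subrr.
  have := rho_tri (x a n.+1) (x a (i + n).+1) (x a (i + n).+2).
  move: (step a (i + n)%N) IH; rewrite addSn exprS invfM mulrA divff//.
  by set r := (2 ^+ _)^-1; set r' := (2 ^+ _)^-1; lra.
have pow_gt0 k : 0 < 2 / 2 ^+ k :> R by rewrite divr_gt0// exprn_gt0.
have le_step a n k : (n <= k)%N -> rho (x a n.+1) (x a k.+1) <= 2 / 2 ^+ n.
  by move=> /subnK <-; have := steps a n (k - n)%N; have := pow_gt0 (k - n + n)%N; lra.
have /choice[f fP] a : exists y, metric_cvg rho (x a) y.
  apply: rho_complete => e e0; have [|n ne] := two_over_expn_small (e / 2); first by lra.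
  exists n.+1 => -[//|i] [//|j] ni nj.
  have := rho_tri (x a i.+1) (x a n.+1) (x a j.+1); rewrite [rho (x a i.+1) (x a n.+1)]rhoC.
  by have := le_step a n i ni; have := le_step a n j nj; lra.
have fx a n : rho (f a) (x a n.+1) <= 2 / 2 ^+ n.
  apply/ler_addgt0Pr => e e0; have [N NP] := fP a e e0.
  have := NP (maxn N n).+1 (leq_trans (leq_maxl N n) (leqnSn _)).
  have := le_step a n (maxn N n) (leq_maxr N n).
  have := rho_tri (f a) (x a (maxn N n).+1) (x a n.+1).
  by rewrite [rho (x a (maxn N n).+1) _]rhoC; lra.
exists f; split=> [n a b ab|m a b ab neq].
  have xx : x a n.+1 = x b n.+1 by rewrite /x; congr (_.1 _); apply: eq_rev_prefix.
  have := rho_tri (f a) (x a n.+1) (f b); have := fx a n; have := fx b n.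
  rewrite -xx [rho (f b) _]rhoC; have -> : 4 / 2 ^+ n = 2 / 2 ^+ n + 2 / 2 ^+ n :> R by lra.
  by set r := 2 / _; lra.
(* From level [m] on both prefixes grow by the same bit, so [extends] preserves the witness between
   them and [narrow] stabilises its entries; closedness of [K] then gives a witness for the
   limits. *)
pose w_ n := (c n).2 (rev_prefix a n) (rev_prefix b n).
have w_step n i : (m <= n.+1)%N -> (i <= n)%N -> w_ n.+2 i = w_ n.+1 i.
  move=> mn inn; have [ex _] := PS n.+1; have [c0 Pc0 [_ h]] := ex _ (cP n.+2) (a n.+1).
  rewrite /w_ -![rev_prefix _ n.+2]/(_ n.+1 :: rev_prefix _ n.+1) -ab// h ?size_rev_prefix//.
  by have [_ /(_ _ _ Pc0 (cP n.+1))[_]] := PS n; apply; rewrite ?size_rev_prefix.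
have w_le n i k : (m <= n.+1)%N -> (i <= n)%N -> w_ (k + n).+1 i = w_ n.+1 i.
  move=> mn inn; elim: k => // k IH; rewrite addSn w_step//.
    by rewrite (leq_trans mn)// ltnS leq_addl.
  by rewrite (leq_trans inn)// leq_addl.
apply/K_far; exists (fun i => w_ (maxn m i).+1 i).
apply: (K_closed (x a) (x b) w_) => //.
  move=> i; exists (maxn m i).+1 => -[//|n]; rewrite ltnS => min.
  rewrite -(subnK min) w_le// ?leq_maxr//.
  by rewrite (leq_trans (leq_maxl m i)).
exists m => n mn; have [_ /(_ _ (cP n))] := Pgood n; apply; rewrite ?size_rev_prefix//.
move=> /rev_prefix_inj h; apply: neq; apply/funext => i.
by have [/ab//|im] := leqP m i; apply: h; apply: leq_trans im mn.
Qed.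

End CantorScheme.

(** Stage [n] assigns a box to each string of length [n.+1] so that, for [k <= n], the product of
    the boxes of any two distinct strings misses [N k]. Distinct [a] and [b] have distinct prefixes
    at all late stages. *)
Lemma mycielski (M : set (nat -> bool * bool)) : box_meagre M ->
  exists g : (nat -> bool) -> nat -> bool,
    (forall a b n, (forall i, (i <= n)%N -> a i = b i) -> g a n = g b n) /\
    forall a b, a <> b -> ~ M (fun i => (g a i, g b i)).
Proof.
move=> [N nN MN].
pose avoids (hD : (seq bool -> nat -> bool) * seq nat) k u v := forall a b,
  agree hD.2 (hD.1 u) a -> agree hD.2 (hD.1 v) b -> ~ N k (fun i => (a i, b i)).
pose refines (hD hD' : (seq bool -> nat -> bool) * seq nat) :=
  {subset hD.2 <= hD'.2} /\ forall u, agree hD.2 (hD.1 u) (hD'.1 u).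
have avoidsS hD hD' k u v : refines hD hD' -> avoids hD k u v -> avoids hD' k u v.
  move=> [DD' hh'] av a b ua vb; apply: av.
    by apply: agree_trans (hh' u) _; apply: agreeS ua.
  by apply: agree_trans (hh' v) _; apply: agreeS vb.
have refine1 hD k u v : u != v -> exists2 hD', refines hD hD' & avoids hD' k u v.
  case: hD => h D uv; have [z [D' [DD' hz zN]]] := nN k (fun i => (h u i, h v i)) D.
  exists (fun s => if s == u then fst \o z else if s == v then snd \o z else h s, D').
    split=> // s i iD /=; case: eqP => [->|_]; first by rewrite /= -hz.
    by case: eqP => [->|//]; rewrite /= -hz.
  move=> a b /=; rewrite eqxx [v == u]eq_sym (negbTE uv) eqxx => za zb; apply: zN => i iD.
  by rewrite -za// -zb//=; case: (z i).
have refine hD (L : seq (nat * seq bool * seq bool)) : exists2 hD', refines hD hD' &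
    forall k u v, (k, u, v) \in L -> u != v -> avoids hD' k u v.
  elim: L => [|[[k u] v] L [hD1 r1 av1]]; first by exists hD => //; split=> // u i.
  have trans hD2 : refines hD1 hD2 -> refines hD hD2.
    move: r1 => [DD1 h1] [DD2 h2]; split=> [i /DD1/DD2//|w].
    by apply: agree_trans (h1 w) _; apply: agreeS (h2 w).
  have [->|uv] := eqVneq u v.
    exists hD1 => // k' u' v'; rewrite in_cons => /predU1P[[_ -> ->]|/av1//].
    by rewrite eqxx.
  have [hD2 r2 av2] := refine1 hD1 k u v uv; exists hD2; first exact: trans.
  move=> k' u' v'; rewrite in_cons => /predU1P[[-> -> ->]//|/av1 h /h].
  exact: avoidsS.
have [||f [_ _ fS]] := @dependent_choice_nat _ (fun=> setT)
  (fun n hD hD' => [/\ {subset hD.2 <= hD'.2}, n \in hD'.2,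
    forall b u, agree hD.2 (hD.1 u) (hD'.1 (b :: u)) &
    forall k u v, (k <= n)%N -> size u = n.+1 -> size v = n.+1 -> u != v ->
      avoids hD' k u v]) (fun _ _ => true, [::]) => //.
  move=> n [h D] _.
  (* Both children of a string start from its box, via [behead]. Adding [n] to the domain decides
     coordinate [n], whence the modulus of continuity of [g]. *)
  have [hD' [DD' hh'] av] := refine (fun u => h (behead u), n :: D)
    [seq (k, p.1, p.2) | k <- iota 0 n.+1,
      p <- [seq (u, v) | u <- strings n.+1, v <- strings n.+1]].
  exists hD' => //; split=> /=.
  - by move=> i iD; apply: DD'; rewrite in_cons iD orbT.
  - by apply: DD'; rewrite mem_head.
  - by move=> b u i iD; apply: (hh' (b :: u)); rewrite in_cons iD orbT.
  move=> k u v kn un vn; apply: av; apply/allpairsP; exists (k, (u, v)); split=> //.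
    by rewrite mem_iota.
  by apply/allpairsP; exists (u, v); split=> //=; apply: mem_strings.
have /choice[g gP] a : exists z, forall n, agree (f n).2 ((f n).1 (rev_prefix a n)) z.
  apply: (box_limit true (fun n => (f n).1 (rev_prefix a n)) (fun n => (f n).2)) => n.
    by have [] := fS n.
  by have [_ _ + _] := fS n; apply.
exists g; split=> [a b n ab|a b ab /MN[k]].
  have [_ nD _ _] := fS n; rewrite -(gP a n.+1)// -(gP b n.+1)//.
  by rewrite (@eq_rev_prefix a b).
have [i ne] : exists i, a i <> b i.
  by apply: contrapT => no; apply: ab; apply/funext => i; apply: contrapT => ?; apply: no; exists i.
have [_ _ _ /(_ k (rev_prefix a (maxn i k).+1) (rev_prefix b (maxn i k).+1))] := fS (maxn i k).
rewrite !size_rev_prefix leq_maxr => /(_ isT erefl erefl)av.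
apply: av (gP _ _) (gP _ _); apply/eqP => /rev_prefix_inj/(_ i) h; apply: ne; apply: h.
by rewrite ltnS leq_maxl.
Qed.

Lemma separated_cantor_set {R : realType} {X : topologicalType} (d : X -> X -> R) (eps : R) :
  polish R X -> borel_pseudo_metric d -> 0 < eps -> ~ delta_separable d eps ->
  exists h : (nat -> bool) -> X,
    (forall a U, nbhs (h a) U ->
      exists n, forall b, (forall i, (i <= n)%N -> a i = b i) -> U (h b)) /\
    forall a b, a <> b -> eps / 2 <= d (h a) (h b).
Proof.
move=> [[x0 _] [S cS dS] [rho [mrho rhoX crho]]] [pd bd] e0 nsep.
have [prho _] := mrho; have [_ _ dC dtri] := pd.
have [q qS] := countable_enumeration S x0 cS.
have ballX x e : 0 < e -> nbhs x [set y | rho x y < e] by move=> ?; apply/rhoX; exists e.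
have [|K Kc KP] := @souslin_borel R X rho mrho rhoX
    ((fun p => d p.1 p.2) @^-1` (~` [set r | r < eps])).
  by apply: bd; apply: borel_setC; apply: sub_sigma_algebra; exact: open_lt.
have [|||f [fcont ffar]] := @cantor_scheme R X rho d q eps K prho _ _ pd Kc _ nsep.
- move=> u /crho[l ul]; exists l => e /(ballX l)/ul[N _ NP]; exists N => n Nn.
  exact: (NP n Nn).
- move=> x e xe; have [y [xy /qS[k qk]]] : ([set y | rho x y < e]° `&` S) !=set0.
    apply: dS; last exact: open_interior.
    by exists x; apply: ballX.
  by exists k; rewrite qk; apply: (interior_subset xy).
- by move=> x y; rewrite -(KP x y) /= leNgt; split=> /negP.
have fnbhs a U : nbhs (f a) U ->
    exists n, forall b, (forall i, (i <= n)%N -> a i = b i) -> U (f b).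
  move=> /rhoX[e xe eU]; have [|n ne] := two_over_expn_small (e / 2); first by lra.
  exists n => b ab; apply: eU; apply: le_lt_trans (fcont n a b ab) _.
  by move: ne; set r := _^-1; lra.
pose F (z : nat -> bool * bool) := (f (fst \o z), f (snd \o z)).
have [M mM RM] : baire_property (F @^-1` ((fun p => d p.1 p.2) @^-1` [set r | r < eps / 2])).
  apply: baire_property_borel_preimage; last first.
    by apply: bd; apply: sub_sigma_algebra; exact: open_lt.
  move=> U z oU Uz; have [[P Q] /= [/fnbhs[n nP] /fnbhs[m mQ]] PQ] : nbhs (F z) U.
    exact: open_nbhs_nbhs.
  exists (iota 0 (maxn n m).+1) => y zy; apply: PQ; split=> /=.
    by apply: nP => i ni /=; rewrite zy// mem_iota ltnS leq_max ni.
  by apply: mQ => i ni /=; rewrite zy// mem_iota ltnS leq_max ni orbT.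
have [g [gcont gM]] := mycielski M mM.
exists (f \o g); split=> [a U /fnbhs[n nU]|a b ab].
  exists n => b ab; apply: nU => i ni; apply: gcont => j ji; apply: ab.
  exact: leq_trans ji ni.
rewrite leNgt; apply/negP => dab; have {}gM := gM a b ab.
have [D DP] := RM _ gM.
pose k := (\max_(i <- D) i).+1.
have kD : k \notin D.
  by apply/negP => /(@leq_bigmax_seq _ _ predT id)/(_ isT); rewrite ltnn.
pose flip (z : nat -> bool * bool) i := if i == k then ((z i).1, ~~ (z i).2) else z i.
(* On the box [D] the set of close pairs is comeagre, so it contains two pairs that
   differ in a single bit of the second coordinate. *)
have [z zD /not_orP[zM zfM]] : exists2 z, agree D (fun i => (g a i, g b i)) z &
    ~ (M `|` [set z | M (flip z)]) z.
  apply: baire; apply: box_meagreU => //.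
  apply: (@box_meagre_preimage _ _ _
    (fun i (p : bool * bool) => if i == k then (p.1, ~~ p.2) else p)) => // i [p1 p2].
  by case: eqP => _; [exists (p1, ~~ p2); rewrite /= negbK|exists (p1, p2)].
have close y : agree D (fun i => (g a i, g b i)) y -> ~ M y ->
    d (f (fst \o y)) (f (snd \o y)) < eps / 2.
  by move=> yD yM; apply/(DP y yD yM).
have c1 := close z zD zM.
have c2 : d (f (fst \o z)) (f (snd \o flip z)) < eps / 2.
  have -> : fst \o z = fst \o flip z by apply/funext => i; rewrite /flip /=; case: eqP.
  apply: close zfM; apply: agree_trans zD _ => i iD; rewrite /flip; case: eqP => // ik.
  by rewrite -ik iD in kD.
(* The second coordinates differ at [k] only, so they share a tail and their images are [eps] apart,
   although both are within [eps / 2] of one point. *)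
have : eps <= d (f (snd \o z)) (f (snd \o flip z)).
  apply: (ffar k.+1) => [i ki|/(congr1 (fun u => u k))]; first by rewrite /flip /= gtn_eqF.
  by rewrite /flip /= eqxx; case: (z k).2.
have := dtri (f (snd \o z)) (f (fst \o z)) (f (snd \o flip z)).
by rewrite [d (f (snd \o z)) (f (fst \o z))]dC; lra.
Qed.

(** * The reduction of [E_one] *)

Lemma nbhs_agree {I : eqType} (D : seq I) (x : {ptws I -> bool}) :
  nbhs x [set y | agree D x y].
Proof.
elim: D => [|i D IH]; first by apply: filterS filterT => y _ i.
have xi : nbhs x [set y : {ptws I -> bool} | x i = y i].
  have ci : (fun y : {ptws I -> bool} => y i) @ x --> x i.
    exact: (@proj_continuous_prod I (fun=> (bool : topologicalType)) i x).
  have bi : nbhs (x i) [set b | x i = b].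
    rewrite (_ : [set b | x i = b] = [set x i]); first exact: discrete_set1.
    by apply/seteqP; split=> b /= ->.
  exact: ci bi.
apply: filterS (filterI xi IH) => y [yi yD] j; rewrite in_cons.
by move=> /predU1P[->//|/yD].
Qed.

Lemma E_one_reducible_E_zero (R : realType) (X : nat -> topologicalType)
    (d : forall n : nat, X n -> X n -> R) (eps : R) :
  (forall n, polish R (X n)) -> (forall n, borel_pseudo_metric (d n)) -> 0 < eps ->
  (forall N, exists2 n, (N <= n)%N & ~ delta_separable (d n) eps) ->
  borel_reducible E_one (E_zero d).
Proof.
move=> pX bd e0 nsep.
(* On an [eps]-separable [X n] a constant map will do: infinitely many separating coordinates
   suffice. *)
have hex n : {h : (nat -> bool) -> X n |
    (forall a U, nbhs (h a) U ->
      exists k, forall b, (forall i, (i <= k)%N -> a i = b i) -> U (h b)) /\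
    (~ delta_separable (d n) eps -> forall a b, a <> b -> eps / 2 <= d n (h a) (h b))}.
  apply: cid; have [sep|nsepn] := pselect (delta_separable (d n) eps).
    have [[x0 _] _ _] := pX n; exists (fun=> x0); split=> // a U /nbhs_singleton Ux0.
    by exists 0%N.
  by have [h [hc hs]] := separated_cantor_set (d n) eps (pX n) (bd n) e0 nsepn;
    exists h; split.
pose h n := sval (hex n).
have hcont n a U : nbhs (h n a) U ->
    exists k, forall b, (forall i, (i <= k)%N -> a i = b i) -> U (h n b).
  by move: a U; rewrite /h; case: (hex n) => /= g [].
have hfar n : ~ delta_separable (d n) eps -> forall a b, a <> b ->
    eps / 2 <= d n (h n a) (h n b).
  by rewrite /h; case: (hex n) => /= g [].
(* The [n]-th coordinate encodes all the columns of [x] from the [n]-th on. *)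
pose tail n (x : {ptws nat * nat -> bool}) l :=
  if @unpickle (nat * nat)%type l is Some p then x (n + p.1, p.2)%N else false.
pose theta (x : {ptws nat * nat -> bool}) : prod_topology X := fun n => h n (tail n x).
exists theta.
  apply: continuous_borel_fun => x; apply/cvg_sup => n U [V] [[W] oW <-] WfN WU.
  apply: (filterS WU); have [|k kW] := hcont n (tail n x) W.
    exact: open_nbhs_nbhs.
  pose D := [seq (if @unpickle (nat * nat)%type l is Some p then (n + p.1, p.2)%N else (0, 0)%N)
    | l <- iota 0 k.+1].
  apply: filterS (nbhs_agree D x) => y xy; apply: kW => l lk; rewrite /tail.
  case El : unpickle => [p|//]; apply: xy; apply/mapP; exists l; rewrite ?El//.
  by rewrite mem_iota.
move=> x y; rewrite /E_zero near0P; split=> [[m xy] e ep|xy].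
  exists m => n mn; have [[_ d0 _ _] _] := bd n.
  suff -> : theta x n = theta y n by rewrite d0 normr0.
  congr (h n _); apply/funext => l; rewrite /tail; case: unpickle => // p.
  by apply: xy; apply: leq_trans mn _; apply: leq_addr.
(* At a non-separable [n >= N] the images are closer than [eps / 2], which forces equal tails, that
   is, equality of all columns from [n] on. *)
have [|N NP] := xy (eps / 2); first by lra.
have [n /NP dn /hfar far] := nsep N; exists n => i ni k; apply: contrapT => xyik.
have [[d_ge0 _ _ _] _] := bd n; move: dn; rewrite ger0_norm// ltNge => /negP; apply.
apply: far => /(congr1 (fun u => u (pickle ((i - n)%N, k)))).
by rewrite /tail pickleK /= subnKC.
Qed.

Theorem theorem3p4 (R : realType) (X : nat -> topologicalType)
    (d : forall n : nat, X n -> X n -> R)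
    (polishX : forall n : nat, polish R (X n))
    (borel_d : forall n : nat, borel_pseudo_metric (d n)) :
  ((fun n : nat => delta_of (d n)) @ \oo --> (0%E : \bar R) <->
     borel_reducible (E_zero d) (@RN_mod_c0 R)) /\
  (~ ((fun n : nat => delta_of (d n)) @ \oo --> (0%E : \bar R)) <->
     borel_reducible E_one (E_zero d)).
Proof.
have to_c0 : (fun n : nat => delta_of (d n)) @ \oo --> (0%E : \bar R) ->
    borel_reducible (E_zero d) (@RN_mod_c0 R).
  move=> /delta_of_cvg0P; apply: E_zero_reducible_c0 => // n.
  by have [] := polishX n.
have from_E1 : ~ ((fun n : nat => delta_of (d n)) @ \oo --> (0%E : \bar R)) ->
    borel_reducible E_one (E_zero d).
  rewrite delta_of_cvg0P => /existsNP[e /not_implyP[e0 /forallNP nsep]].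
  apply: (E_one_reducible_E_zero R X d e) => // N.
  have /existsNP[n /not_implyP[Nn ?]] := nsep N.
  by exists n.
have disjoint : borel_reducible E_one (E_zero d) ->
    borel_reducible (E_zero d) (@RN_mod_c0 R) -> False.
  move=> E1E Ec0; apply: (E_one_not_reducible_c0 R).
  exact: borel_reducible_trans E1E Ec0.
by split; split=> //; [move=> Ec0; apply: contrapT => /from_E1 /disjoint|
  move=> E1E /to_c0; apply: disjoint].
Qed.
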